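(* The set of Legendre multiplier sequences is a strict subset of the set of Hermite multiplier sequences: every Legendre multiplier sequence is a Hermite multiplier sequence, and there exist Hermite multiplier sequences that are not Legendre multiplier sequences.
   Context: The Legendre polynomials $\mathfrak{Le}_n(x)$ are defined by $\frac{1}{\sqrt{1-2xt+t^2}}=\sum_{k=0}^{\infty}\mathfrak{Le}_k(x)t^k$, and the Hermite polynomials by $H_n(x)=(-1)^ne^{x^2}\frac{d^n}{dx^n}e^{-x^2}$. For a simple set of real polynomials $Q=\{q_k\}_{k=0}^\infty$ (i.e. $\deg q_k=k$), a real sequence $\{\gamma_k\}_{k=0}^{\infty}$ is a $Q$-multiplier sequence if the linear operator $T$ on $\mathbb{R}[x]$ defined by $T[q_k]=\gamma_k q_k$ maps every real polynomial having only real zeros to a polynomial having only real zeros. Legendre (resp. Hermite) multiplier sequences are the $Q$-multiplier sequences for $Q=\{\mathfrak{Le}_k\}$ (resp. $Q=\{H_k\}$). *)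

(* Defs.v *)
From mathcomp Require Import all_boot all_order all_algebra.
From mathcomp Require Import complex.
From mathcomp Require Import Rstruct.
From Stdlib Require Import Reals.
From Coquelicot Require Import Coquelicot.
Set Implicit Arguments.
Unset Strict Implicit.
Unset Printing Implicit Defensive.
Import GRing.Theory Num.Theory.

Notation RR := Rdefinitions.R.

Local Open Scope ring_scope.

(* A real polynomial has only real zeros: all its complex zeros are real.
   Convention (standard in the multiplier-sequence literature): the zero
   polynomial is also regarded as having only real zeros. *)
Definition only_real_zeros (p : {poly RR}) : Prop :=
  p = 0 \/
  forall z : RR[i], root (map_poly (fun r : RR => Complex r 0) p) z -> Im z = 0.

(* Q-multiplier sequence for a sequence of real polynomials q
   (in the theorem q will be a simple set: size (q k) = k.+1). *)
Definition Q_multiplier_sequence (q : nat -> {poly RR}) (gamma : nat -> RR)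
  : Prop :=
  forall T : {linear {poly RR} -> {poly RR}},
    (forall k, T (q k) = gamma k *: q k) ->
    forall p, only_real_zeros p -> only_real_zeros (T p).

Local Close Scope ring_scope.
Local Open Scope R_scope.

Definition is_legendre_family (Le : nat -> {poly RR}) : Prop :=
  forall x : RR, exists r : RR, 0 < r /\
    forall t : RR, Rabs t < r ->
      is_series (fun k => (horner (Le k) x * t ^ k))
                (/ sqrt (1 - 2 * x * t + t ^ 2)).

Definition is_hermite_family (H : nat -> {poly RR}) : Prop :=
  forall (n : nat) (x : RR),
    horner (H n) x =
      (-1) ^ n * exp (x ^ 2) * Derive_n (fun y => exp (- (y ^ 2))) n x.

Definition legendre_multiplier_sequence (Le : nat -> {poly RR})
  (gamma : nat -> RR) : Prop := Q_multiplier_sequence Le gamma.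

Definition hermite_multiplier_sequence (H : nat -> {poly RR})
  (gamma : nat -> RR) : Prop := Q_multiplier_sequence H gamma.

(* Main.v *)
(* A Legendre multiplier sequence g also acts on monomials, x^k -> g_k x^k,
   preserving real-rootedness (a scaling limit), so the Jensen polynomials of
   all its shifts are real-rooted. The coefficient of x^n in T x^(n+2) is a
   positive multiple of g_n - g_(n+2), and real-rootedness of T x^(n+2) gives
   g_(n+2) g_n <= g_(n+2)^2; with Turan's inequality, |g| is nondecreasing from
   its first nonzero term on, unless g has at most two nonzero terms. Then the
   Jensen polynomials have all their roots in [-1, 0], and the Bernstein-type
   transform x -> x / (1 - x) turns them into polynomials f in the falling
   factorial basis, products of factors a x + b with a, b >= 0, whose values
   converge to g. Each factor acts on the Hermite side as p -> b p + a (x - D/2) p',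
   which preserves stability in the upper half plane.
   The sequence g_k = k is a single such factor; in the Legendre case it sends
   (x + 1)^3 to a polynomial violating Laguerre's inequality. *)
Require Import Defs.
From HB Require Import structures.
From mathcomp Require Import all_boot all_order all_algebra.
From mathcomp Require Import complex.
From mathcomp Require Import Rstruct.
From Stdlib Require Classical_Prop.
From mathcomp Require Import polyrcf zify ring lra.

Set Implicit Arguments.
Unset Strict Implicit.
Unset Printing Implicit Defensive.
Import Order.TTheory GRing.Theory Num.Theory.

Local Open Scope ring_scope.
Local Open Scope complex_scope.

(** * Polynomials stable in the upper half plane *)

(** The Hermite side is proved for complex polynomials because its inductive step tests an operator
    on p' - l p with l a complex number, which a statement about real polynomials does not reach.
    For real coefficients stability and real-rootedness agree by conjugation; both admit the zero
    polynomial, so that limits stay in the class. The falling factorial basis comes from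
    n(n-1)...(n-i) = n ((n-1)...(n-i)): in it, multiplication by X turns g_n into n g_(n-1), and
    conjugating a Hermite-diagonal operator with derivative and raising does the same to its
    eigenvalues. The bound -1 on Jensen roots matters because a root r becomes the factor (1 + r) x
    - r, whose coefficients are nonnegative only for -1 <= r <= 0. Monotonicity of g yields the
    bound only for suitable large shifts, hence a descent on the shift. Sequences that end in zeros
    escape this argument. Quartic test polynomials in x^2 leave them at most two nonzero terms, and
    then every image lies in the span of two consecutive Hermite polynomials. *)

Definition upper_stable (R : rcfType) (p : {poly R[i]}) :=
  forall z : R[i], 0 < complex.Im z -> root p z -> p = 0.

Section Stable.
Variable R : rcfType.
Implicit Types (p q u v : {poly R[i]}) (z w : R[i]).
Local Notation Im := (@complex.Im R).
Local Notation Re := (@complex.Re R).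

Lemma Im_inv_lt0 z : 0 < Im z -> Im z^-1 < 0.
Proof.
case: z => a b /= b0; rewrite oppr_lt0 divr_gt0 //.
by rewrite ltr_wpDl ?sqr_ge0 // exprn_gt0.
Qed.

Lemma ImD z w : Im (z + w) = Im z + Im w.
Proof. by case: z => a b; case: w. Qed.

Lemma ImN z : Im (- z) = - Im z.
Proof. by case: z. Qed.

Lemma Im_realM (a : R) z : Im (a%:C * z) = a * Im z.
Proof. by case: z => x y /=; rewrite mul0r addr0. Qed.

(** P'/P is the sum of the 1/(z - r), and each z - r lies in the upper half-plane. *)
Lemma logderiv_prod_XsubC_Im (rs : seq R[i]) z :
  rs != [::] -> all (fun r => Im r <= 0) rs -> 0 < Im z ->
  let P := \prod_(r <- rs) ('X - r%:P) in Im (P^`().[z] / P.[z]) < 0.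
Proof.
elim: rs => // r rs IH _ /= /andP[rle rsle] z0.
rewrite big_cons derivM derivXsubC mul1r !hornerE.
have zr : Im (z - r) > 0 by rewrite ImD ImN; lra.
have zr0 : z - r != 0 by apply: contraTneq zr => ->; rewrite ltxx.
have [rs0|rs0] := eqVneq rs [::].
  rewrite rs0 big_nil derivC !(hornerE, mulr0, addr0, mulr1, mul1r).
  exact: Im_inv_lt0.
have := IH rs0 rsle z0; set P := \prod_(_ <- _) _ => /= IH'.
have P0 : P.[z] != 0.
  by apply: contraTneq IH' => /= ->; rewrite invr0 mulr0 ltxx.
have -> : (P.[z] + (z - r) * P^`().[z]) / ((z - r) * P.[z]) =
          (z - r)^-1 + P^`().[z] / P.[z] by field; rewrite zr0 P0.
by rewrite ImD; have := Im_inv_lt0 zr; lra.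
Qed.

Lemma upper_stable_prod p : upper_stable p ->
  exists2 rs : seq R[i], p = lead_coef p *: \prod_(r <- rs) ('X - r%:P) &
    p != 0 -> all (fun r => Im r <= 0) rs.
Proof.
move=> pst; have [rs prs] := closed_field_poly_normal p.
exists rs => // p0; apply/allP => r rin; rewrite leNgt; apply/negP => r0.
suff /(pst _ r0)/eqP : root p r by rewrite (negPf p0).
by rewrite prs rootZ ?lead_coef_eq0 // root_prod_XsubC.
Qed.

Lemma upper_stable_logderiv p z :
  upper_stable p -> (1 < size p)%N -> 0 < Im z ->
  p.[z] != 0 /\ Im (p^`().[z] / p.[z]) < 0.
Proof.
move=> pst sp z0; have p0 : p != 0 by rewrite -size_poly_gt0 ltnW.
have [rs prs /(_ p0) rsle] := upper_stable_prod pst.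
have rs0 : rs != [::].
  apply: contraTneq sp => rs0.
  by rewrite prs rs0 big_nil alg_polyC size_polyC; case: eqP.
have := logderiv_prod_XsubC_Im rs0 rsle z0.
set P := \prod_(_ <- _) _ in prs * => /= Plt.
have P0 : P.[z] != 0 by apply: contraTneq Plt => /= ->; rewrite invr0 mulr0 ltxx.
have l0 : lead_coef p != 0 by rewrite lead_coef_eq0.
rewrite prs derivZ !hornerZ mulf_neq0 //; split=> //.
by rewrite -mulf_div divff // mul1r.
Qed.

(** At a zero of p' - l p in the upper half-plane p'/p would equal l, while Im (p'/p) < 0 there. *)
Lemma upper_stable_derivB p (l : R[i]) :
  0 <= Im l -> upper_stable p -> upper_stable (p^`() - l *: p).
Proof.
move=> l0 pst; have [/size1_polyC ->|sp] := leqP (size p) 1.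
  rewrite derivC sub0r -scaleN1r scalerA -mul_polyC -polyCM => z _.
  by rewrite rootC => /eqP->.
move=> z z0; have [pz lt0] := upper_stable_logderiv pst sp z0.
rewrite rootE !hornerE subr_eq0 => /eqP e; move: lt0.
by rewrite e mulfK // ltNge l0.
Qed.

Lemma upper_stable_deriv p : upper_stable p -> upper_stable p^`().
Proof.
by move=> /(@upper_stable_derivB _ 0 (lexx _)); rewrite scale0r subr0.
Qed.

(* For a root r below the real axis, |w - r| <= |z - r| + |w - z| <= 3/2 |z - r|. *)
Lemma upper_stable_growth q n z w :
  upper_stable q -> (size q <= n.+1)%N -> 0 < Im z ->
  `|w - z| <= (Im z / 2)%:C -> `|q.[w]| <= (3 / 2) ^+ n * `|q.[z]|.
Proof.
move=> qst sq z0 wz; have [->|q0] := eqVneq q 0.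
  by rewrite !horner0 normr0 mulr0.
have [rs qrs /(_ q0) rsle] := upper_stable_prod qst.
have l0 : lead_coef q != 0 by rewrite lead_coef_eq0.
have srs : (size rs <= n)%N.
  by rewrite -ltnS -(size_prod_XsubC rs id) -(size_scale _ l0) -qrs.
rewrite qrs !hornerZ !normrM mulrCA ler_wpM2l //.
apply: (@le_trans _ _ ((3 / 2) ^+ size rs *
    `|(\prod_(r <- rs) ('X - r%:P)).[z]|)); last first.
  rewrite ler_wpM2r // ler_weXn2l //.
  by rewrite ler_pdivlMr ?mul1r ?ler_nat ?ltr0n.
elim: rs {qrs srs} rsle => [|r rs IH] /=; first by rewrite big_nil !hornerE.
move=> /andP[r0 /IH{}IH]; rewrite big_cons !hornerM !normrM exprS mulrACA.
apply: ler_pM => //; rewrite !hornerE.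
have zr : (Im z)%:C <= `|z - r|.
  rewrite normc_def lecR -[X in X <= _](ger0_norm (ltW z0)) -sqrtr_sqr.
  by rewrite ler_wsqrtr // ImD ImN; have := sqr_ge0 (Re (z - r)); nra.
rewrite -(subrK z w) -addrA (le_trans (ler_normD _ _)) //.
have -> : 3 / 2 * `|z - r| = `|z - r| / 2 + `|z - r| by field.
rewrite lerD2r (le_trans wz) // rmorphM /= fmorphV rmorph_nat.
by rewrite ler_pM2r // invr_gt0 ltr0n.
Qed.

(* A zero z of the limit forces, by [upper_stable_growth], infinitely many zeros
   near z. *)
Lemma upper_stable_closed p n :
  (forall e : R, 0 < e -> exists2 q, upper_stable q /\ (size q <= n.+1)%N &
     forall i, `|q`_i - p`_i| <= e%:C) ->
  upper_stable p.
Proof.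
move=> H z z0 /rootP pz.
have sp : (size p <= n.+1)%N.
  apply/leq_sizeP => j nj; apply/eqP; rewrite -normr_eq0; apply: contraT.
  have nE : `|p`_j| = (Re `|p`_j|)%:C by rewrite normc_def.
  rewrite -normr_gt0 normr_id nE ltcR => pj.
  have [q [_ /leq_sizeP/(_ _ nj) qj] /(_ j)] := H _ (divr_gt0 pj (ltr0n R 2)).
  by rewrite qj sub0r normrN nE lecR; set a := Re _ in pj * => ?; exfalso; lra.
have approx w (e : R) : 0 < e -> exists2 d : R, 0 < d & forall q,
    (size q <= n.+1)%N -> (forall i, `|q`_i - p`_i| <= d%:C) ->
    `|q.[w] - p.[w]| <= e%:C.
  move=> e0; pose S := \sum_(i < n.+1) complex.Re `|w| ^+ i.
  have wE : `|w| = (Re `|w|)%:C by rewrite normc_def.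
  have w0 : 0 <= Re `|w| by rewrite -ler0c -wE.
  have S0 : 0 <= S by apply: sumr_ge0 => i _; rewrite exprn_ge0.
  exists (e / (S + 1)); first by rewrite divr_gt0 //; lra.
  move=> q sq qp; rewrite (horner_coef_wide _ sq) (horner_coef_wide _ sp).
  rewrite -sumrB (le_trans (ler_norm_sum _ _ _)) //.
  apply: (@le_trans _ _ ((e / (S + 1))%:C * S%:C)).
    rewrite rmorph_sum mulr_sumr ler_sum // => i _.
    rewrite -mulrBl normrM normrX rmorphXn /= -wE.
    by rewrite ler_wpM2r ?exprn_ge0.
  rewrite -rmorphM lecR mulrAC ler_pdivrMr; last lra.
  by rewrite ler_wpM2l; lra.
have pw w : `|w - z| <= (Im z / 2)%:C -> p.[w] = 0.
  move=> wz; apply/eqP; rewrite -normr_eq0; apply: contraT.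
  rewrite -normr_gt0 normr_id; have wE : `|p.[w]| = (Re `|p.[w]|)%:C.
    by rewrite normc_def.
  rewrite wE ltcR; set a := Re _ in wE * => a0.
  pose K : R := (3 / 2) ^+ n; have K1 : 1 <= K by rewrite exprn_ege1 //; lra.
  (* With errors e = a / (4 K) at w and at z, |p(w)| <= e + K e <= a / 2, below a = |p(w)|. *)
  have e0 : 0 < a / (4 * K) by rewrite divr_gt0 //; lra.
  have [d1 d10 H1] := approx w _ e0; have [d2 d20 H2] := approx z _ e0.
  have dm : 0 < Num.min d1 d2 by rewrite lt_min d10.
  have [q [qst sq] qp] := H _ dm.
  have qpw : `|q.[w] - p.[w]| <= (a / (4 * K))%:C.
    by apply: H1 => // i; rewrite (le_trans (qp i)) // lecR ge_min lexx.
  have qpz : `|q.[z] - p.[z]| <= (a / (4 * K))%:C.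
    by apply: H2 => // i; rewrite (le_trans (qp i)) // lecR ge_min lexx orbT.
  have := upper_stable_growth qst sq z0 wz; rewrite pz subr0 in qpz.
  have -> : (3 / 2) ^+ n = K%:C :> R[i].
    by rewrite rmorphXn rmorphM fmorphV !rmorph_nat.
  have : `|p.[w]| <= `|q.[w] - p.[w]| + `|q.[w]|.
    by have := ler_normD (p.[w] - q.[w]) q.[w]; rewrite subrK distrC.
  have K0 : 0 <= K%:C :> R[i] by rewrite ler0c; lra.
  move=> h1 h2; have := le_trans h1 (lerD qpw (le_trans h2 (ler_wpM2l K0 qpz))).
  rewrite wE -rmorphM -rmorphD lecR.
  have -> : K * (a / (4 * K)) = a / 4 by field; lra.
  have : a / (4 * K) <= a / 4.
    rewrite ler_pdivrMr ?mulr_gt0 //; [|lra].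
    by have -> : a / 4 * (4 * K) = a * K by [field]; nra.
  lra.
apply/eqP; apply: contraT => p0.
(* Distinct points of the disc where p vanishes, one more than the degree allows. *)
pose ws := [seq z + ((Im z / 2) / k.+1%:R)%:C | k <- iota 0 (size p)].
have : (size ws < size p)%N.
  apply: max_poly_roots => //.
    apply/allP => w /mapP[k _ ->]; apply/rootP/pw.
    rewrite addrAC subrr add0r normc_def /= expr0n addr0 sqrtr_sqr lecR.
    have k0 : 0 < k.+1%:R :> R by rewrite ltr0n.
    rewrite ger0_norm ?ler_pdivrMr ?divr_ge0 ?ler0n //; try lra.
    by have : 1 <= k.+1%:R :> R by [rewrite ler1n]; nra.
  rewrite map_inj_uniq ?iota_uniq // => k l /addrI /complexI.
  move=> /(mulfI _) h; have /h/invr_inj/eqP : Im z / 2 != 0 by lra.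
  by rewrite eqr_nat => /eqP[].
by rewrite size_map size_iota ltnn.
Qed.

End Stable.

(** * Diagonal operators and Hermite polynomials *)

Section Diag.
Variables (F : fieldType) (q : nat -> {poly F}).
Implicit Types p r : {poly F}.

Section Operator.
Variable g : nat -> F.

(** Reads the coordinates in the basis [q] from the top degree down. For a fixed [n] this is linear
    in [p]; [diag_op] takes the number of steps from [p], and [diag_opE] lets two polynomials share
    it. *)
Fixpoint diag_trunc n (p : {poly F}) : {poly F} :=
  if n is m.+1 then
    let a := p`_m / (q m)`_m in (a * g m) *: q m + diag_trunc m (p - a *: q m)
  else 0.

Definition diag_op p := diag_trunc (size p) p.

Lemma diag_trunc_linear n (a : F) p r :
  diag_trunc n (a *: p + r) = a *: diag_trunc n p + diag_trunc n r.
Proof.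
elim: n a p r => [|n IH] a p r /=; first by rewrite scaler0 addr0.
rewrite coefD coefZ mulrDl -mulrA.
set b := p`_n / _; set c := r`_n / _.
have -> : a *: p + r - (a * b + c) *: q n = a *: (p - b *: q n) + (r - c *: q n).
  by rewrite scalerBr scalerA scalerDl opprD addrACA.
rewrite IH -!mul_polyC !(polyCM, polyCD); ring.
Qed.

Lemma diag_opE n p : (size p <= n)%N -> diag_op p = diag_trunc n p.
Proof.
move=> /subnKC <-; elim: (n - _)%N => [|k IH]; first by rewrite addn0.
rewrite addnS /= nth_default ?leq_addr // !mul0r !scale0r subr0 add0r.
exact: IH.
Qed.

Lemma diag_op_is_linear : linear diag_op.
Proof.
move=> a p r; pose n := maxn (size p) (size r).
rewrite !(@diag_opE n) ?diag_trunc_linear ?leq_maxl ?leq_maxr //.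
by rewrite (leq_trans (size_polyD _ _)) // geq_max leq_maxr andbT
     (leq_trans (size_scale_leq _ _)) // leq_maxl.
Qed.

HB.instance Definition _ :=
  @GRing.isLinear.Build F {poly F} {poly F} *:%R diag_op diag_op_is_linear.

End Operator.

Lemma eq_diag_op g1 g2 : g1 =1 g2 -> diag_op g1 =1 diag_op g2.
Proof.
move=> g12 p; rewrite /diag_op; move: (size p) => n; elim: n p => //= n IH p.
by rewrite g12 IH.
Qed.

Hypothesis size_q : forall k, size (q k) = k.+1.

Lemma simple_set_lead k : (q k)`_k != 0.
Proof.
by have := lead_coef_eq0 (q k); rewrite lead_coefE -size_poly_eq0 size_q => ->.
Qed.

Lemma diag_op_basis g k : diag_op g (q k) = g k *: q k.
Proof.
rewrite /diag_op size_q /= divff ?simple_set_lead // mul1r scale1r subrr.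
by rewrite -(@diag_opE g k 0) ?size_poly0 // linear0 addr0.
Qed.

Lemma simple_set_span n p : (size p <= n)%N ->
  exists c : nat -> F, p = \sum_(k < n) c k *: q k.
Proof.
elim: n p => [|n IH] p sp.
  exists (fun=> 0); by move: sp; rewrite big_ord0 size_poly_leq0 => /eqP.
pose a := p`_n / (q n)`_n.
have [|c pc] := IH (p - a *: q n).
  apply/leq_sizeP => j nj; rewrite coefB coefZ.
  have [->|jn] := eqVneq j n; first by rewrite divfK ?simple_set_lead ?subrr.
  have {}nj : (n < j)%N by rewrite ltn_neqAle eq_sym jn.
  by rewrite !nth_default ?mulr0 ?subr0 ?size_q // (leq_trans sp).
exists (fun k => if k == n then a else c k).
rewrite big_ord_recr /= eqxx -[LHS](subrK (a *: q n)) pc; congr (_ + _).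
by apply: eq_bigr => k _; rewrite ltn_eqF.
Qed.

Lemma linear_eq_simple_set (V : lmodType F) (S T : {linear {poly F} -> V}) :
  (forall k, S (q k) = T (q k)) -> forall p, S p = T p.
Proof.
move=> ST p; have [c ->] := simple_set_span (leqnn (size p)).
by rewrite !linear_sum; apply: eq_bigr => k _; rewrite !linearZ ST.
Qed.

Variables (g : nat -> F) (T : {linear {poly F} -> {poly F}}).
Hypothesis Tq : forall k, T (q k) = g k *: q k.

(** Hence the quantification over [T] in [Q_multiplier_sequence] concerns a single operator. *)
Lemma eigen_diag_op p : T p = diag_op g p.
Proof.
apply: (linear_eq_simple_set (T := diag_op g)) => k.
by rewrite Tq; apply/esym/diag_op_basis.
Qed.

Lemma eigen_size_le n p : (size p <= n)%N -> (size (T p) <= n)%N.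
Proof.
move=> /simple_set_span[c ->]; rewrite linear_sum.
apply: (leq_trans (size_sum _ _ _)); apply/bigmax_leqP => k _.
rewrite linearZ /= Tq scalerA (leq_trans (size_scale_leq _ _)) //.
by rewrite size_q.
Qed.

Lemma eigen_coef n p : (size p <= n.+1)%N -> (T p)`_n = g n * p`_n.
Proof.
move=> /simple_set_span[c ->]; rewrite linear_sum !coef_sum mulr_sumr.
apply: eq_bigr => k _; rewrite linearZ Tq !coefZ.
have [->|kn] := eqVneq (k : nat) n; first by ring.
by rewrite [(q k)`_n]nth_default ?mulr0 // size_q ltn_neqAle kn -ltnS /=.
Qed.

Lemma eigen_size p : (forall k, g k != 0) -> size (T p) = size p.
Proof.
move=> g0; have [->|p0] := eqVneq p 0; first by rewrite linear0.
have sp : (size p).-1.+1 = size p by rewrite prednK // size_poly_gt0.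
apply/eqP; rewrite eqn_leq eigen_size_le // leqNgt; apply/negP => lt.
have := @eigen_coef (size p).-1 p; rewrite sp => /(_ (leqnn _)).
rewrite -lead_coefE [LHS]nth_default; last by rewrite -ltnS sp.
move=> /esym/eqP.
by rewrite mulf_eq0 lead_coef_eq0 (negPf p0) (negPf (g0 _)).
Qed.

End Diag.

Lemma size_deriv_num (F : numDomainType) (p : {poly F}) :
  size p^`() = (size p).-1.
Proof.
rewrite /deriv; case e : (size p) => [|[|n]].
- by rewrite poly_def big_ord0 size_poly0.
- by rewrite poly_def big_ord0 size_poly0.
rewrite size_poly_eq // mulrn_eq0 /=.
by have := lead_coef_eq0 p; rewrite lead_coefE e /= -size_poly_eq0 e => ->.
Qed.

(** The recurrence that differentiating H_n(x) e^(-x^2) produces; it makes sense over the reals and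
    over their complexification alike. *)
Fixpoint hermite (F : nzRingType) n : {poly F} :=
  if n is m.+1 then ('X * hermite F m) *+ 2 - (hermite F m)^`() else 1.

Lemma map_hermite (F G : nzRingType) (f : {rmorphism F -> G}) n :
  map_poly f (hermite F n) = hermite G n.
Proof.
elim: n => [|n IH] /=; first by rewrite rmorph1.
by rewrite rmorphB rmorphMn rmorphM /= map_polyX -deriv_map IH.
Qed.

(** * The raising operator and Hermite-diagonal operators *)

Section HermiteRaise.
Variable F : numFieldType.

Definition hermite_raise (u : {poly F}) := 'X * u - 2^-1 *: u^`().

Lemma hermite_raise_is_linear : linear hermite_raise.
Proof.
move=> a p r; rewrite /hermite_raise derivD derivZ -!mul_polyC; ring.
Qed.

HB.instance Definition _ :=
  @GRing.isLinear.Build F {poly F} {poly F} *:%R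
    hermite_raise hermite_raise_is_linear.

Lemma hermite_raiseE n : hermite_raise (hermite F n) = 2^-1 *: hermite F n.+1.
Proof.
rewrite /= /hermite_raise scalerBr -scaler_nat scalerA mulVf ?scale1r //.
by rewrite pnatr_eq0.
Qed.

Lemma size_hermite n : size (hermite F n) = n.+1.
Proof.
elim: n => [|n IH] /=; first by rewrite size_poly1.
have h0 : hermite F n != 0 by rewrite -size_poly_gt0 IH.
have s : size (('X * hermite F n) *+ 2) = n.+2.
  by rewrite -scaler_nat size_scale ?pnatr_eq0 // mulrC size_mulX // IH.
by rewrite size_polyDl s // size_polyN (leq_trans (lt_size_deriv h0)) // IH.
Qed.

Lemma deriv_hermite n : (hermite F n)^`() = n%:R *: hermite F n.-1 *+ 2.
Proof.
elim: n => [|n IH]; first by rewrite /= derivC scale0r mul0rn.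
rewrite [hermite _ _.+1]/= derivB derivMn derivM derivX mul1r IH derivMn derivZ.
case: n IH => [|n] IH.
  by rewrite scale0r mul0rn mulr0 !addr0 derivC scale0r mul0rn subr0 scale1r.
rewrite [_.+1.-1]/= [_.+2.-1]/= [hermite _ n.+1]/= -!scaler_nat -!mul_polyC.
have -> : n.+2%:R = n.+1%:R + 1 :> F by rewrite natr1.
rewrite polyCD polyC1; ring.
Qed.

Local Notation H := (hermite F).

Lemma diag_hermiteZ c (g : nat -> F) p :
  diag_op H (fun n => c * g n) p = c *: diag_op H g p.
Proof.
apply/esym; pose T : {linear {poly F} -> {poly F}} := c \*: diag_op H g.
apply: (eigen_diag_op size_hermite (T := T)) => k.
by rewrite /= (diag_op_basis size_hermite) scalerA.
Qed.

Lemma diag_hermite1 p : diag_op H (fun=> 1) p = p.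
Proof.
apply/esym; apply: (eigen_diag_op size_hermite (T := idfun)) => k /=.
by rewrite scale1r.
Qed.

(** On H_k the derivative gives 2k H_(k-1), the operator of [g] multiplies by g_(k-1), and raising
    returns to H_k / 2: the eigenvalue is k g_(k-1). At k = 0 the factor k cancels the meaningless
    index. *)
Lemma diag_hermite_step a b (g : nat -> F) p :
  diag_op H (fun n => b * g n + a * n%:R * g n.-1) p =
  b *: diag_op H g p + a *: hermite_raise (diag_op H g p^`()).
Proof.
apply/esym; pose T : {linear {poly F} -> {poly F}} :=
  b \*: diag_op H g \+ a \*: (hermite_raise \o diag_op H g \o @deriv F).
apply: (eigen_diag_op size_hermite (T := T)) => k.
have e1 : diag_op H g (H k)^`() = (2 * k%:R * g k.-1) *: H k.-1.
  rewrite deriv_hermite -scaler_nat scalerA.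
  rewrite (linearZ_LR (diag_op H g)).
  apply: etrans (congr1 (fun u => _ *: u) (diag_op_basis size_hermite _ _)) _.
  by rewrite scalerA.
have e2 : hermite_raise ((2 * k%:R * g k.-1) *: H k.-1) =
    (k%:R * g k.-1) *: H k.-1.+1.
  rewrite (linearZ_LR hermite_raise).
  apply: etrans (congr1 (fun u => _ *: u) (hermite_raiseE _)) _.
  by rewrite scalerA; congr (_ *: _); field.
rewrite /T [LHS]/= e1 e2 (diag_op_basis size_hermite).
move: (H) => h; case: k {e1 e2} => [|k].
  by rewrite !mul0r scale0r mulr0 mul0r scaler0 !addr0 scalerA.
by rewrite -pred_Sn !scalerA -scalerDl mulrA.
Qed.

End HermiteRaise.

(** The image of [f] under the linear map X^i -> x(x-1)...(x-i+1), evaluated at n. *)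
Definition falling_eval (F : nzRingType) (f : {poly F}) (n : nat) : F :=
  \sum_(i < size f) f`_i * (n ^_ i)%:R.

Section FallingEval.
Variable F : comNzRingType.

Lemma falling_eval_wide N (f : {poly F}) n : (size f <= N)%N ->
  falling_eval f n = \sum_(i < N) f`_i * (n ^_ i)%:R.
Proof.
move=> sf; rewrite /falling_eval (big_ord_widen _ (fun i => f`_i * (n ^_ i)%:R) sf).
rewrite big_mkcond; apply: eq_bigr => i _; case: ltnP => // h.
by rewrite nth_default ?mul0r.
Qed.

Lemma falling_evalZ c (f : {poly F}) n :
  falling_eval (c *: f) n = c * falling_eval f n.
Proof.
rewrite (falling_eval_wide _ (size_scale_leq _ _)) mulr_sumr.
by apply: eq_bigr => i _; rewrite coefZ mulrA.
Qed.

(** The falling power of n of order i + 1 is n times that of n - 1 of order i. The right side is the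
    eigenvalue of [diag_hermite_step]. *)
Lemma falling_eval_mul a b (f : {poly F}) n :
  falling_eval ((a *: 'X + b%:P) * f) n =
  b * falling_eval f n + a * n%:R * falling_eval f n.-1.
Proof.
have s1 : (size ((a *: 'X + b%:P) * f)%R <= (size f).+1)%N.
  apply/leq_sizeP => [[|j]] // jf; rewrite mulrDl -scalerAl mul_polyC.
  by rewrite coefD !coefZ coefXM /= !nth_default ?mulr0 ?addr0 // ltnW.
rewrite (falling_eval_wide _ s1) (falling_eval_wide _ (leqnSn _)).
rewrite /falling_eval !mulr_sumr big_ord_recl [X in X + _ = _]/=.
rewrite [X in _ = X + _]big_ord_recl.
rewrite mulrDl -scalerAl mul_polyC !coefD !coefZ coefXM /= mulr0 add0r mulrA.
rewrite -addrA; congr (_ + _); rewrite -big_split.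
apply: eq_bigr => i _; rewrite coefD !coefZ coefXM /= ffactnS natrM; ring.
Qed.

End FallingEval.

(** * Sequences preserving stability in the Hermite basis *)

Definition hermite_stable (R : rcfType) (g : nat -> R) :=
  forall p : {poly R[i]},
    upper_stable p -> upper_stable (diag_op (hermite R[i]) (fun n => (g n)%:C) p).

Section HermiteStable.
Variable R : rcfType.
Implicit Types (p u v : {poly R[i]}) (g : nat -> R).
Local Notation Im := (@complex.Im R).
Local Notation H := (hermite R[i]).
Local Notation size_H := (@size_hermite R[i]).

Lemma eq_hermite_stable g1 g2 : g1 =1 g2 -> hermite_stable g1 -> hermite_stable g2.
Proof.
move=> g12 st p /st; rewrite (@eq_diag_op _ _ _ (fun n => (g2 n)%:C)) //.
by move=> n; rewrite g12.
Qed.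

Lemma upper_stableZ (c : R[i]) p : upper_stable p -> upper_stable (c *: p).
Proof.
have [->|c0] := eqVneq c 0; first by move=> _ z; rewrite scale0r.
by move=> pst z z0; rewrite rootZ // => /(pst _ z0) ->; rewrite scaler0.
Qed.

Lemma upper_stable_logderiv_le u z : upper_stable u -> u != 0 -> 0 < Im z ->
  u.[z] != 0 /\ Im (u^`().[z] / u.[z]) <= 0.
Proof.
move=> ust u0 z0; have [su|su] := leqP (size u) 1; last first.
  by have [? /ltW] := upper_stable_logderiv ust su z0.
have uz : u.[z] != 0 by apply: contraNneq u0 => /eqP /(ust _ z0) ->.
by split=> //; rewrite [X in X^`()](size1_polyC su) derivC horner0 mul0r.
Qed.

(** A zero z satisfies z = (u'/u)(z) / 2, whose imaginary part is nonpositive. *)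
Lemma upper_stable_raise u : upper_stable u -> upper_stable (hermite_raise u).
Proof.
move=> ust; have [->|u0] := eqVneq u 0; first by rewrite linear0.
move=> z z0; have [uz h] := upper_stable_logderiv_le ust u0 z0.
rewrite rootE !hornerE subr_eq0 => /eqP e; exfalso.
have : z = (2^-1)%:C * (u^`().[z] / u.[z]).
  apply: (mulIf uz); rewrite e -mulrA divfK //.
  by rewrite fmorphV rmorph_nat.
by move=> /(congr1 Im); rewrite Im_realM; lra.
Qed.

Lemma hermite_stableZ c g : hermite_stable g -> hermite_stable (fun n => c * g n).
Proof.
move=> st p /st/(@upper_stableZ c%:C); rewrite -diag_hermiteZ.
rewrite (@eq_diag_op _ _ _ (fun n => (c * g n)%:C)) // => n.
by rewrite rmorphM.
Qed.

Lemma hermite_stable1 : hermite_stable (fun=> 1 : R).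
Proof. by move=> p; rewrite diag_hermite1. Qed.

Lemma diag_hermite_realE (a b : R) g p :
  diag_op H (fun n => (b * g n + a * n%:R * g n.-1)%:C) p =
  b%:C *: diag_op H (fun n => (g n)%:C) p +
  a%:C *: hermite_raise (diag_op H (fun n => (g n)%:C) p^`()).
Proof.
rewrite -diag_hermite_step; apply: eq_diag_op => n.
by rewrite rmorphD !rmorphM rmorph_nat.
Qed.

(** The case b = 0: derivative and raising preserve stability separately, and no sum has to be
    controlled. *)
Lemma hermite_stable_step0 g : hermite_stable g ->
  hermite_stable (fun n => n%:R * g n.-1).
Proof.
move=> st; apply: (@eq_hermite_stable (fun n => 0 * g n + 1 * n%:R * g n.-1)).
  by move=> n; rewrite mul0r add0r mul1r.
move=> p pst; rewrite diag_hermite_realE scale0r add0r scale1r.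
exact/upper_stable_raise/st/upper_stable_deriv.
Qed.

(* With S the operator of g and l = S p' / S p at z, the image of the stable
   polynomial p' - l p vanishes at z if Im l >= 0; hence Im l < 0. *)
Lemma hermite_stable_step (a b : R) g :
  0 <= a -> 0 < b -> (forall n, 0 < g n) -> hermite_stable g ->
  hermite_stable (fun n => b * g n + a * n%:R * g n.-1).
Proof.
move=> a0 b0 g0 st p pst; rewrite diag_hermite_realE.
pose S := diag_op H (fun n => (g n)%:C); rewrite -/S.
have sizeS r : size (S r) = size r.
  apply: (eigen_size size_H (diag_op_basis size_H _)) => k.
  by rewrite fmorph_eq0 gt_eqF.
have [sp|sp] := leqP (size p) 1.
  have -> : p^`() = 0 by rewrite [p](size1_polyC sp) derivC.
  rewrite /S !linear0 addr0.
  exact: upper_stableZ (st _ pst).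
move=> z z0.
have sp' : (0 < size p^`())%N by rewrite size_deriv_num -ltnS prednK // ltnW.
have u0 : S p^`() != 0 by rewrite -size_poly_gt0 sizeS.
have v0 : S p != 0 by rewrite -size_poly_gt0 sizeS ltnW.
have [uz Imu] := upper_stable_logderiv_le (st _ (upper_stable_deriv pst)) u0 z0.
have [vz _] := upper_stable_logderiv_le (st _ pst) v0 z0.
pose l := (S p^`()).[z] / (S p).[z].
have l0 : Im l < 0.
  rewrite ltNge; apply/negP => l0.
  have := st _ (upper_stable_derivB l0 pst) z z0.
  rewrite linearB linearZ /= -/S rootE !hornerE /l divfK // subrr eqxx.
  (* Stability makes this image zero; then p' and p would have the same size, since S preserves
     sizes. *)
  move=> /(_ isT)/eqP; rewrite subr_eq0 => /eqP/(congr1 (fun r => size (r : {poly _}))).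
  rewrite size_scale ?sizeS; last by rewrite mulf_neq0 ?invr_eq0.
  rewrite size_deriv_num => e; move: (sp); rewrite -e.
  by case: (size p) e => // n /= /n_Sn.
rewrite rootE !hornerE => /eqP e; exfalso.
(* The equation divided by (S p')(z). The first summand has positive imaginary part because Im l <
   0, the second a nonnegative one. *)
have : b%:C * l^-1 + a%:C * (z + (- 2^-1)%:C * ((S p^`())^`().[z] / (S p^`()).[z])) = 0.
  apply: (mulIf uz); rewrite mul0r -[RHS]e /l rmorphN fmorphV rmorph_nat.
  by field; rewrite uz vz.
move=> /(congr1 Im); rewrite ImD !Im_realM ImD Im_realM.
have il : 0 < Im l^-1.
  have := @Im_inv_lt0 _ (- l); rewrite ImN invrN ImN; lra.
set x := Im (_ / _) in Imu *; set y := Im l^-1 in il *.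
have h1 : 0 < b * y by rewrite mulr_gt0.
have h2 : 0 <= a * (Im z + - 2^-1 * x) by rewrite mulr_ge0 //; lra.
by rewrite /=; lra.
Qed.

Lemma falling_eval1 n : falling_eval (1 : {poly R}) n = 1.
Proof. by rewrite /falling_eval size_poly1 big_ord1 coef1 ffactn0 mulr1. Qed.

(** The factors with b > 0 are applied first and keep all values positive, as [hermite_stable_step]
    requires; the factors X, which create zeros at small n, come last. *)
Lemma hermite_stable_falling_eval c l (s : seq (R * R)) :
  all (fun ab => (0 <= ab.1) && (0 < ab.2)) s ->
  hermite_stable
    (falling_eval (c *: ('X^l * \prod_(ab <- s) (ab.1 *: 'X + ab.2%:P)))).
Proof.
move=> sP; apply: (@eq_hermite_stable (fun n => c * falling_eval
    ('X^l * \prod_(ab <- s) (ab.1 *: 'X + ab.2%:P)) n)) => [n|].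
  by rewrite falling_evalZ.
apply: hermite_stableZ.
elim: l => [|l IH]; last first.
  apply: eq_hermite_stable (hermite_stable_step0 IH) => n.
  have -> : 'X^(l.+1) = (1 *: 'X + 0%:P) * 'X^l :> {poly R}.
    by rewrite scale1r polyC0 addr0 exprS.
  by rewrite -mulrA falling_eval_mul mul0r add0r mul1r.
suff [] : hermite_stable (falling_eval (\prod_(ab <- s) (ab.1 *: 'X + ab.2%:P)))
  /\ forall n, 0 < falling_eval (\prod_(ab <- s) (ab.1 *: 'X + ab.2%:P)) n.
  by rewrite expr0 mul1r.
elim: s sP => [_|[a b] s IH /= /andP[/andP[a0 b0] /IH[st pos]]].
  rewrite big_nil; split=> [|n]; last by rewrite falling_eval1.
  by apply: eq_hermite_stable hermite_stable1 => n; rewrite falling_eval1.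
rewrite big_cons /=; split=> [|n].
  by apply: eq_hermite_stable (hermite_stable_step a0 b0 pos st) => n;
     rewrite falling_eval_mul.
rewrite falling_eval_mul ltr_wpDr ?mulr_ge0 ?ler0n ?(ltW (pos _)) //.
by rewrite mulr_gt0.
Qed.

(** On a fixed [p] the operator reads only finitely many terms of [g], so its coefficients converge
    and [upper_stable_closed] applies. *)
Lemma hermite_stable_closed g :
  (forall d (e : R), 0 < e -> exists2 f, hermite_stable f &
     forall n, (n <= d)%N -> `|f n - g n| <= e) ->
  hermite_stable g.
Proof.
move=> app p pst; pose d := size p.
have [c pc] := simple_set_span size_H (leqnn d).
pose B : R := \sum_(i < d) \sum_(k < d) complex.Re `|c k * (H k)`_i|.
have B0 : 0 <= B.
  apply: sumr_ge0 => i _; apply: sumr_ge0 => k _.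
  by rewrite -ler0c normc_def /= lecR sqrtr_ge0.
have diagE f : diag_op H (fun n => (f n)%:C) p =
    \sum_(k < d) ((f k)%:C * c k) *: H k.
  rewrite [in LHS]pc linear_sum; apply: eq_bigr => k _.
  by rewrite linearZ /= (diag_op_basis size_H) scalerA mulrC.
clear pc.
apply: (@upper_stable_closed _ _ d) => e e0.
have [|f fst fg] := app d (e / (B + 1)); first by rewrite divr_gt0 //; lra.
exists (diag_op H (fun n => (f n)%:C) p); first split; first exact: fst.
  rewrite ltnW // ltnS; exact: (eigen_size_le size_H (diag_op_basis size_H _)).
move=> i; rewrite !diagE -coefB -sumrB coef_sum (le_trans (ler_norm_sum _ _ _)) //.
apply: (@le_trans _ _ ((e / (B + 1))%:C * B%:C)); last first.
  rewrite -rmorphM lecR mulrAC ler_pdivrMr; last lra.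
  by rewrite ler_wpM2l; lra.
have [di|id] := leqP d i.
  rewrite big1 ?mulr_ge0 ?ler0c ?divr_ge0 //; try lra.
  move=> k _; rewrite -scalerBl coefZ nth_default ?mulr0 ?normr0 //.
  by rewrite size_H (leq_trans (ltn_ord k)).
apply: (@le_trans _ _ ((e / (B + 1))%:C *
    (\sum_(k < d) complex.Re `|c k * (H k)`_i|)%:C)).
  rewrite rmorph_sum mulr_sumr ler_sum // => k _.
  rewrite -scalerBl -mulrBl coefZ -mulrA normrM -rmorphB.
  have -> : `|(f k - g k)%:C| = `|f k - g k|%:C.
    by rewrite normc_def /= expr0n addr0 sqrtr_sqr.
  have nE (z : R[i]) : (complex.Re `|z|)%:C = `|z| by rewrite normc_def.
  rewrite [X in _ <= _ * X]nE ler_wpM2r // lecR fg //.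
  by rewrite ltnW.
rewrite ler_wpM2l ?ler0c ?divr_ge0 ?(ltW e0) ?addr_ge0 //.
rewrite lecR [leRHS](bigD1 (Ordinal id)) // lerDl.
apply: sumr_ge0 => j _; apply: sumr_ge0 => k _.
by rewrite -ler0c normc_def /= lecR sqrtr_ge0.
Qed.

End HermiteStable.

(** * Real-rooted polynomials *)

Definition real_rooted (R : rcfType) (p : {poly R}) :=
  upper_stable (map_poly (real_complex R) p).

Section RealRooted.
Variable R : rcfType.
Implicit Types (p q : {poly R}).
Local Notation "p ^C" := (map_poly (real_complex R) p).

Lemma real_rooted_real p z : real_rooted p -> p != 0 -> root p^C z ->
  complex.Im z = 0.
Proof.
move=> prr p0 rz; have pC0 : p^C != 0 by rewrite map_poly_eq0.
have [z0|z0|//] := ltgtP (complex.Im z) 0.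
  have /prr : 0 < complex.Im (z^*)%C by case: (z) z0 => a b /=; rewrite oppr_gt0.
  have -> : root p^C (z^*)%C.
    rewrite -complex_root_conj -map_poly_comp.
    rewrite (eq_map_poly (g := real_complex R)) // => x /=.
    by rewrite oppr0.
  by move=> /(_ isT)/eqP; rewrite (negPf pC0).
by have /eqP := prr _ z0 rz; rewrite (negPf pC0).
Qed.

Lemma real_rootedM p q : real_rooted p -> real_rooted q -> real_rooted (p * q).
Proof.
move=> pr qr z z0; rewrite rmorphM rootM => /orP[/(pr _ z0)|/(qr _ z0)] e.
  by rewrite /= e mul0r.
by rewrite /= e mulr0.
Qed.

Lemma real_rooted_divl p q : p != 0 -> real_rooted (p * q) -> real_rooted q.
Proof.
move=> p0 pqr z z0 rz; have /(pqr _ z0)/eqP : root (p * q)^C z.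
  by rewrite rmorphM rootM rz orbT.
by rewrite rmorphM mulf_eq0 map_poly_eq0 (negPf p0) => /eqP.
Qed.

Lemma real_rootedC c : real_rooted (c%:P : {poly R}).
Proof. by move=> z _; rewrite map_polyC rootC => /eqP ->. Qed.

Lemma real_rootedZ c p : real_rooted p -> real_rooted (c *: p).
Proof. by rewrite -mul_polyC; apply: real_rootedM; apply: real_rootedC. Qed.

Lemma real_rooted_XsubC a : real_rooted ('X - a%:P : {poly R}).
Proof.
move=> z z0; rewrite rmorphB /= map_polyX map_polyC root_XsubC => /eqP e.
by move: z0; rewrite e /= ltxx.
Qed.

Lemma real_rooted_linear a b : real_rooted (a *: 'X + b%:P : {poly R}).
Proof.
have [->|a0] := eqVneq a 0; first by rewrite scale0r add0r; apply: real_rootedC.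
have -> : a *: 'X + b%:P = a *: ('X - (- b / a)%:P) :> {poly R}.
  by rewrite scalerBr -[X in _ - X]mul_polyC -polyCM mulrC divfK // polyCN opprK.
exact/real_rootedZ/real_rooted_XsubC.
Qed.

Lemma real_rootedXn p n : real_rooted p -> real_rooted (p ^+ n).
Proof.
move=> pr; elim: n => [|n IH]; first by rewrite expr0; apply: real_rootedC.
by rewrite exprS; apply: real_rootedM.
Qed.

Lemma real_rootedX n : real_rooted ('X^n : {poly R}).
Proof. by apply: real_rootedXn; rewrite -['X]subr0; apply: real_rooted_XsubC. Qed.

Lemma real_rooted_prod (I : Type) (s : seq I) (F : I -> {poly R}) :
  (forall i, real_rooted (F i)) -> real_rooted (\prod_(i <- s) F i).
Proof.
move=> Fr; elim: s => [|i s IH]; first by rewrite big_nil; apply: real_rootedC.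
by rewrite big_cons; apply: real_rootedM.
Qed.

Lemma real_rooted_split p : real_rooted p ->
  exists rs : seq R, p = lead_coef p *: \prod_(r <- rs) ('X - r%:P).
Proof.
have [n] := ubnP (size p); elim: n p => // n IH p sp pr.
have [p1|p1] := leqP (size p) 1.
  exists [::]; rewrite big_nil [p in LHS](size1_polyC p1) alg_polyC.
  by rewrite [p in RHS](size1_polyC p1) lead_coefC.
have p0 : p != 0 by rewrite -size_poly_gt0 ltnW.
have [z rz] : exists z, root p^C z.
  by apply/closed_rootP; rewrite size_map_poly gtn_eqF.
have := real_rooted_real pr p0 rz; case: z rz => a b + /= b0.
rewrite b0 -[a +i* 0]/(a%:C) fmorph_root => /factor_theorem[q pq].
have q0 : q != 0 by apply: contraNneq p0 => q0; rewrite pq q0 mul0r.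
have sq : size p = (size q).+1 by rewrite pq size_Mmonic ?monicXsubC // size_XsubC addn2.
have [||rs qrs] := IH q.
- by rewrite sq in sp.
- by apply: (@real_rooted_divl ('X - a%:P)); rewrite ?polyXsubC_eq0 // mulrC -pq.
exists (a :: rs); rewrite big_cons {1}pq {1}qrs mulrC scalerAr.
by rewrite pq lead_coef_Mmonic ?monicXsubC.
Qed.

Lemma comp_polyZX p c : p \Po (c *: 'X) = \poly_(i < size p) (p`_i * c ^+ i).
Proof.
rewrite comp_polyE poly_def; apply: eq_bigr => i _.
by rewrite exprZn scalerA.
Qed.

Lemma coef_comp_polyZX p c i : (p \Po (c *: 'X))`_i = p`_i * c ^+ i.
Proof.
by rewrite comp_polyZX coef_poly; case: ltnP => // h; rewrite nth_default ?mul0r.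
Qed.

Lemma real_rooted_scale p c : real_rooted p -> real_rooted (p \Po (c *: 'X)).
Proof.
move=> /real_rooted_split[rs ->]; rewrite comp_polyZ; apply: real_rootedZ.
rewrite rmorph_prod; apply: real_rooted_prod => r.
rewrite /= comp_polyB comp_polyX comp_polyC -polyCN.
exact: real_rooted_linear.
Qed.

(** L / P^2 is the sum of the 1/(x - r)^2. Without division: a new factor X - r turns L into P^2 +
    (x - r)^2 L. *)
Lemma laguerre_prod (rs : seq R) x :
  let P := \prod_(r <- rs) ('X - r%:P) in
  let L := P^`().[x] ^+ 2 - P.[x] * P^`()^`().[x] in
  0 <= L /\ (rs != [::] -> P.[x] != 0 -> 0 < L).
Proof.
elim: rs => [|r rs [IH _]] /=.
  by rewrite big_nil derivC deriv0 !hornerE; split=> //; lra.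
rewrite big_cons; set P := \prod_(_ <- _) _ in IH *.
have -> : (('X - r%:P) * P)^`().[x] ^+ 2 -
    (('X - r%:P) * P).[x] * (('X - r%:P) * P)^`()^`().[x] =
    P.[x] ^+ 2 + (x - r) ^+ 2 * (P^`().[x] ^+ 2 - P.[x] * P^`()^`().[x]).
  have d1 : (('X - r%:P) * P)^`() = P + ('X - r%:P) * P^`().
    by rewrite derivM derivXsubC mul1r.
  have -> : (('X - r%:P) * P)^`()^`() = P^`() *+ 2 + ('X - r%:P) * P^`()^`().
    by rewrite d1 derivD derivM derivXsubC mul1r addrA.
  rewrite d1 !hornerE; ring.
have h : 0 <= (x - r) ^+ 2 * (P^`().[x] ^+ 2 - P.[x] * P^`()^`().[x]).
  by rewrite mulr_ge0 ?sqr_ge0.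
split=> [|_]; first by rewrite addr_ge0 ?sqr_ge0.
rewrite hornerM mulf_eq0 negb_or => /andP[_ Px].
by rewrite ltr_wpDr // exprn_even_gt0.
Qed.

Lemma laguerre_le p x : real_rooted p ->
  p.[x] * p^`()^`().[x] <= p^`().[x] ^+ 2.
Proof.
move=> /real_rooted_split[rs ->]; have [+ _] := laguerre_prod rs x.
set P := \prod_(_ <- _) _; set c := lead_coef p; rewrite !derivZ !hornerZ => h.
by have := mulr_ge0 (sqr_ge0 c) h; nra.
Qed.

Lemma laguerre_lt p x : real_rooted p -> (1 < size p)%N -> p.[x] != 0 ->
  p.[x] * p^`()^`().[x] < p^`().[x] ^+ 2.
Proof.
move=> /real_rooted_split[rs prs] sp px; have [_ +] := laguerre_prod rs x.
have c0 : lead_coef p != 0.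
  by rewrite lead_coef_eq0 -size_poly_gt0 ltnW.
have rs0 : rs != [::].
  apply: contraTneq sp => rs0.
  by rewrite prs rs0 big_nil alg_polyC size_polyC; case: eqP.
move: px; rewrite prs; set P := \prod_(_ <- _) _ in prs *.
set c := lead_coef p in c0 *; rewrite !derivZ !hornerZ mulf_eq0 negb_or.
move=> /andP[_ px] /(_ rs0 px) h.
have c2 : 0 < c ^+ 2 by rewrite exprn_even_gt0.
by have := mulr_gt0 c2 h; nra.
Qed.

(** Newton's identity p_2 = e_1^2 - 2 e_2. The factor X^2 shifts the indices so that three top
    coefficients exist even for fewer than two roots. *)
Lemma sum_sqr_roots (rs : seq R) (n := size rs)
    (Q := 'X^2 * \prod_(r <- rs) ('X - r%:P)) :
  [/\ Q`_n.+2 = 1, Q`_n.+1 = - \sum_(r <- rs) r &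
   Q`_n.+1 ^+ 2 - 2 * Q`_n = \sum_(r <- rs) r ^+ 2].
Proof.
rewrite {}/Q {}/n; elim: rs => [|r rs [IH1 IH2 IH3]] /=.
  by rewrite !big_nil mulr1 !coefXn /= oppr0; split=> //; ring.
rewrite !big_cons mulrCA; move: IH1 IH2 IH3.
set P := \prod_(_ <- _) _; set n := size rs; set Q := _ * P => IH1 IH2 IH3.
have Q3 : Q`_n.+3 = 0.
  rewrite nth_default // /Q mulrC size_mulXn ?size_prod_XsubC //.
  by rewrite monic_neq0 // monic_prod_XsubC.
rewrite !mulrBl !coefB !coefXM /= !coefCM Q3 IH1 -IH3 IH2.
by split; ring.
Qed.

(** If e_1 = 0, then -2 e_2 is the sum of the squared roots, and e_2 is the ratio of the two
    coefficients. *)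
Lemma top_coef_sign p d : real_rooted p -> (size p <= d.+3)%N -> p`_d.+1 = 0 ->
  p`_d.+2 * p`_d <= 0.
Proof.
move=> pr sp p1; have [->|pd] := eqVneq p`_d.+2 0; first by rewrite mul0r.
have /real_rooted_split[rs prs] := pr.
have {}sp : size p = d.+3.
  by apply/eqP; rewrite eqn_leq sp ltnNge; apply: contra pd => h; rewrite nth_default.
have c0 : lead_coef p != 0 by rewrite lead_coefE sp.
have srs : size rs = d.+2.
  by apply/eqP; rewrite -eqSS -(size_prod_XsubC rs id) -(size_scale _ c0) -prs sp.
have [_] := sum_sqr_roots rs; rewrite srs.
set P := \prod_(_ <- _) _ in prs * => _.
rewrite !coefXnM /= !subSS !subn0.
have -> : P`_d.+1 = 0.
  by apply/eqP; move: p1; rewrite prs coefZ => /eqP; rewrite mulf_eq0 (negPf c0).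
have ge0 : 0 <= \sum_(r <- rs) r ^+ 2 by apply: sumr_ge0 => r _; rewrite sqr_ge0.
rewrite expr2 mul0r sub0r => e; rewrite lead_coefE sp /= in c0 prs *.
rewrite {2}prs coefZ mulrA -expr2 mulr_ge0_le0 ?sqr_ge0 //; lra.
Qed.

Lemma real_rooted_closed p n :
  (forall e : R, 0 < e -> exists2 q, real_rooted q /\ (size q <= n.+1)%N &
     forall i, `|q`_i - p`_i| <= e) ->
  real_rooted p.
Proof.
move=> H; apply: (@upper_stable_closed _ _ n) => e /H[q [qr sq] qp].
exists q^C; first by rewrite size_map_poly.
move=> i; rewrite !coef_map -rmorphB normc_def /= expr0n addr0 sqrtr_sqr lecR.
exact: qp.
Qed.

End RealRooted.

Lemma only_real_zerosP (p : {poly RR}) : only_real_zeros p <-> real_rooted p.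
Proof.
split=> [[->|pr]|pr].
- by rewrite -polyC0; apply: real_rootedC.
- move=> z z0 /pr; rewrite -complexIm => /complexI e.
  by move: z0; rewrite e ltxx.
have [->|p0] := eqVneq p 0; [by left|right=> z rz].
by rewrite -complexIm (real_rooted_real pr p0 rz).
Qed.

Lemma coef_diag_poly (R : nzRingType) (g : nat -> R) (p : {poly R}) i :
  (\poly_(i < size p) (g i * p`_i))`_i = g i * p`_i.
Proof. by rewrite coef_poly; case: ltnP => // h; rewrite nth_default ?mulr0. Qed.

(** * From an arbitrary eigenbasis to the monomials *)

Section EigenDiagonal.
Variables (R : rcfType) (q : nat -> {poly R}) (g : nat -> R).
Variable T : {linear {poly R} -> {poly R}}.
Hypotheses (size_q : forall k, size (q k) = k.+1)
  (Tq : forall k, T (q k) = g k *: q k)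
  (Tr : forall p, real_rooted p -> real_rooted (T p)).

(* T conjugated by x -> tx tends to the diagonal operator as t tends to 0,
   because T is triangular in the monomial basis. *)
Lemma multiplier_monomial p : real_rooted p ->
  real_rooted (\poly_(i < size p) (g i * p`_i)).
Proof.
move=> pr; pose n := size p; pose a k i := (T 'X^k)`_i.
pose B := \sum_(i < n) \sum_(k < n) `|p`_k * a k i|.
have B0 : 0 <= B by apply: sumr_ge0 => i _; apply: sumr_ge0.
apply: (@real_rooted_closed _ _ n) => e e0.
(* The off-diagonal terms carry t^(k - i) with k > i, hence at most t, so their total is at most t B
   <= e. *)
pose t := Num.min 1 (e / (B + 1)).
have t0 : 0 < t by rewrite lt_min ltr01 divr_gt0 //; lra.
have t1 : t <= 1 by rewrite ge_min lexx.
have tB : t * B <= e.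
  apply: (@le_trans _ _ (e / (B + 1) * B)).
    by rewrite ler_wpM2r // ge_min lexx orbT.
  by rewrite mulrAC ler_pdivrMr; nra.
have Tp : T (p \Po (t *: 'X)) = \sum_(k < n) (p`_k * t ^+ k) *: T 'X^k.
  rewrite comp_polyZX poly_def linear_sum; apply: eq_bigr => k _.
  by rewrite linearZ.
have sT : (size (T (p \Po (t *: 'X))) <= n)%N.
  apply: (eigen_size_le size_q Tq); rewrite comp_polyZX; exact: size_poly.
exists (T (p \Po (t *: 'X)) \Po (t^-1 *: 'X)); first split.
- exact/real_rooted_scale/Tr/real_rooted_scale.
- by rewrite comp_polyZX (leq_trans (size_poly _ _)) // ltnW.
move=> i; rewrite coef_comp_polyZX coef_poly -/n; case: ltnP => [ilt|ni]; last first.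
  by rewrite nth_default ?mul0r ?subr0 ?normr0 ?ltW // (leq_trans sT).
rewrite Tp coef_sum mulr_suml (bigD1 (Ordinal ilt)) //= coefZ.
have -> : (T 'X^i)`_i = g i.
  by rewrite (eigen_coef size_q Tq) ?size_polyXn // coefXn eqxx mulr1.
have ti : t ^+ i != 0 by rewrite expf_neq0 // gt_eqF.
rewrite exprVn; have -> : p`_i * t ^+ i * g i / t ^+ i = g i * p`_i by field.
rewrite addrAC subrr add0r.
apply: le_trans tB; rewrite (le_trans (ler_norm_sum _ _ _)) //.
apply: (@le_trans _ _ (t * \sum_(k < n) `|p`_k * a k i|)); last first.
  rewrite ler_pM2l // [leRHS](bigD1 (Ordinal ilt)) // lerDl.
  by apply: sumr_ge0 => j _; apply: sumr_ge0.
rewrite mulr_sumr [leRHS](bigD1 (Ordinal ilt)) //= ler_wpDl ?mulr_ge0 ?(ltW t0) //.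
apply: ler_sum => k ki; rewrite coefZ.
have [ik|ki'] := ltnP i k; last first.
  rewrite [(T 'X^k)`_i]nth_default ?mulr0 ?mul0r ?normr0 ?mulr_ge0 ?(ltW t0) //.
  have kii : (k < i)%N by rewrite ltn_neqAle ki' andbT; exact: ki.
  by rewrite (leq_trans (eigen_size_le size_q Tq (leqnn _))) // size_polyXn.
have -> : p`_k * t ^+ k * (T 'X^k)`_i / t ^+ i = t ^+ (k - i) * (p`_k * a k i).
  rewrite /a -[in t ^+ k](subnK (ltnW ik)) exprD; field; exact: ti.
rewrite normrM normrX (gtr0_norm t0) ler_wpM2r //.
by rewrite -[leRHS]expr1 ler_wiXn2l // ?(ltW t0) // subn_gt0.
Qed.

End EigenDiagonal.

(** * Jensen polynomials *)

Definition jensen (R : nzRingType) (g : nat -> R) n j : {poly R} :=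
  \poly_(k < n.+1) ('C(n, k)%:R * g (k + j)%N).

Section JensenRing.
Variables (R : comNzRingType) (g : nat -> R).

Lemma coef_jensen n j k : (jensen g n j)`_k = 'C(n, k)%:R * g (k + j)%N.
Proof.
rewrite coef_poly ltnS; case: leqP => // nk.
by rewrite bin_small // mul0r.
Qed.

Lemma deriv_jensen n j : (jensen g n.+1 j)^`() = n.+1%:R *: jensen g n j.+1.
Proof.
apply/polyP => k; rewrite coef_deriv coefZ !coef_jensen addSnnS -mulrnAl -mulrnA.
by rewrite mulrA -natrM mulnC -(mul_bin_diag n.+1 k).
Qed.

Lemma jensenS n j : jensen g n.+1 j = jensen g n j + 'X * jensen g n j.+1.
Proof.
apply/polyP => [[|k]]; rewrite coefD coefXM !coef_jensen /=.
  by rewrite !bin0 addr0.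
by rewrite binS natrD mulrDl addSnnS.
Qed.

Lemma jensen0 j : jensen g 0 j = (g j)%:P.
Proof.
apply/polyP => [[|k]]; rewrite coef_jensen coefC ?mul1r //.
by rewrite mul0r.
Qed.

End JensenRing.

(** * Signs of polar derivatives *)

Section PolarSign.
Variable R : realFieldType.
Implicit Types (rs : seq R) (x : R).

Lemma prod_XsubC_sign rs x : all (fun r => x < r) rs ->
  0 < (- 1) ^+ size rs * (\prod_(r <- rs) ('X - r%:P)).[x].
Proof.
elim: rs => [|r rs IH] /=; first by rewrite big_nil hornerC mul1r ltr01.
move=> /andP[xr /IH]; rewrite big_cons hornerM hornerXsubC exprS.
set P := (\prod_(_ <- _) _).[x] => h.
have -> : -1 * (-1) ^+ size rs * ((x - r) * P) = (r - x) * ((-1) ^+ size rs * P).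
  by ring.
by rewrite mulr_gt0 ?subr_gt0.
Qed.

(** With N roots, N P - x P' is P times the sum of the -r/(x - r); for x < r <= 0 each summand is
    nonpositive, and negative if r < 0. The induction is this identity without denominators. *)
Lemma polar_deriv_sign rs x (P := \prod_(r <- rs) ('X - r%:P)) :
  all (fun r => x < r <= 0) rs -> has (fun r => r < 0) rs ->
  (- 1) ^+ size rs * ((size rs)%:R * P.[x] - x * P^`().[x]) < 0.
Proof.
rewrite {}/P => xrs hrs.
suff [_ /(_ hrs)] : let P := \prod_(r <- rs) ('X - r%:P) in
  (- 1) ^+ size rs * ((size rs)%:R * P.[x] - x * P^`().[x]) <= 0 /\
  (has (fun r => r < 0) rs ->
    (- 1) ^+ size rs * ((size rs)%:R * P.[x] - x * P^`().[x]) < 0) by [].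
elim: rs {hrs} xrs => [|r rs IH] /=.
  by rewrite big_nil derivC !hornerE; split => //; lra.
move=> /andP[/andP[xr r0] xrs]; have [IH1 IH2] := IH xrs.
have := @prod_XsubC_sign rs x.
have -> : all (fun r => x < r) rs by apply: sub_all xrs => s /andP[].
move=> /(_ isT); rewrite big_cons; set P := \prod_(_ <- _) _ in IH1 IH2 * => Ppos.
have -> : (-1) ^+ (size rs).+1 * ((size rs).+1%:R * (('X - r%:P) * P).[x] -
    x * (('X - r%:P) * P)^`().[x]) =
  (r - x) * ((- 1) ^+ size rs * ((size rs)%:R * P.[x] - x * P^`().[x])) +
  r * ((- 1) ^+ size rs * P.[x]).
  rewrite derivM derivXsubC mul1r !(hornerXsubC, hornerD, hornerM) exprS.
  rewrite -[(size rs).+1%:R]natr1.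
  by move: P.[x] P^`().[x] (_ ^+ _) (_%:R) => a b c d; ring.
set A := _ * P.[x] in Ppos *; set B := _ * (_ - _) in IH1 IH2 *.
have rx : 0 < r - x by rewrite subr_gt0.
split=> [|/orP[r1|/IH2 B0]]; nra.
Qed.

End PolarSign.

Section PolarStep.
Variable R : rcfType.

(** If (-1)^n G(x) >= 0, both summands have the right sign. Otherwise (-1)^n G, increasing up to b,
    is negative up to x, so all roots of G lie beyond x and [polar_deriv_sign] applies. The nonzero
    coefficient of X^n excludes a multiple of X^(n+1), whose roots are all 0. *)
Lemma polar_deriv_step (G : {poly R}) n (b : R) : b < 0 ->
  real_rooted G -> size G = n.+2 -> (forall i, 0 <= G`_i) -> G`_n != 0 ->
  (forall x, x <= b -> 0 < (- 1) ^+ n * G^`().[x]) ->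
  forall x, x <= b -> 0 < (- 1) ^+ n * (n.+1%:R * G.[x] - x * G^`().[x]).
Proof.
move=> b0 Gr sG G0 Gn G'pos x xb; have x0 : x < 0 by apply: le_lt_trans b0.
have G'x := G'pos x xb; have [h|h] := leP 0 ((- 1) ^+ n * G.[x]).
  have -> : (-1) ^+ n * (n.+1%:R * G.[x] - x * G^`().[x]) =
    n.+1%:R * ((-1) ^+ n * G.[x]) + - x * ((-1) ^+ n * G^`().[x]) by ring.
  apply: ltr_wpDl; first by rewrite mulr_ge0 ?ler0n.
  by rewrite mulr_gt0 // oppr_gt0.
have [rs Grs] := real_rooted_split Gr.
have c0 : lead_coef G != 0 by rewrite lead_coef_eq0 -size_poly_gt0 sG.
have cpos : 0 < lead_coef G by rewrite lt_def c0 G0.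
have srs : size rs = n.+1.
  by apply/eqP; rewrite -eqSS -(size_prod_XsubC rs id) -(size_scale _ c0) -Grs sG.
have Groot r : r \in rs -> G.[r] = 0.
  by move=> rin; apply/rootP; rewrite Grs rootZ // root_prod_XsubC.
have rs_le0 r : r \in rs -> r <= 0.
  move=> /Groot Gr0; rewrite leNgt; apply/negP => r0; move: Gr0; apply/eqP.
  rewrite gt_eqF // horner_coef sG big_ord_recr /= ltr_wpDl //.
    by apply: sumr_ge0 => i _; rewrite mulr_ge0 // exprn_ge0 // ltW.
  by rewrite mulr_gt0 ?exprn_gt0 //; rewrite lead_coefE sG in cpos.
have xrs r : r \in rs -> x < r.
  move=> /Groot Gr0; rewrite ltNge; apply/negP => rx; pose p := (- 1) ^+ n *: G.
  have : p.[r] <= p.[x].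
    apply: (@derplW _ p r x); rewrite ?in_itv /= ?lexx ?rx //.
    move=> y; rewrite in_itv /= => /andP[_ yx].
    by rewrite derivZ hornerZ G'pos // (le_trans (ltW yx)).
  by rewrite !hornerZ Gr0 mulr0 leNgt h.
have hrs : has (fun r => r < 0) rs.
  apply: contraNT Gn => /hasPn rs0.
  have -> : G = lead_coef G *: 'X^(n.+1).
    rewrite [LHS]Grs -srs; congr (_ *: _).
    elim: rs rs_le0 rs0 {xrs Groot Grs srs} => [|r rs IH] le0 ge0.
      by rewrite big_nil.
    rewrite big_cons IH ?exprS => [|s sin|s sin]; first last.
    - by apply: ge0; rewrite inE sin orbT.
    - by apply: le0; rewrite inE sin orbT.
    have -> : r = 0.
      apply/eqP; rewrite eq_le le0 ?mem_head //= leNgt.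
      exact: ge0 _ (mem_head _ _).
    by rewrite subr0.
  by rewrite coefZ coefXn eqn_leq ltnn andbF mulr0.
have := @polar_deriv_sign _ rs x _ hrs; rewrite srs.
have -> : all (fun r => x < r <= 0) rs.
  by apply/allP => r rin; rewrite xrs ?rs_le0.
move=> /(_ isT); rewrite Grs; set P := \prod_(_ <- _) _.
rewrite derivZ !hornerZ exprS => h'.
have -> : (-1) ^+ n * (n.+1%:R * (lead_coef G * P.[x]) -
    x * (lead_coef G * P^`().[x])) =
  lead_coef G * - (-1 * (-1) ^+ n * (n.+1%:R * P.[x] - x * P^`().[x])) by ring.
by rewrite mulr_gt0 // oppr_gt0.
Qed.

End PolarStep.

(** Otherwise N increments of at least e, with N e > 1, would leave [0, 1]. *)
Lemma bounded_small_increment (R : archiRealFieldType) (u : nat -> R) e :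
  0 < e -> (forall k, 0 <= u k <= 1) -> exists k, u k.+1 - u k < e.
Proof.
move=> e0 u01; pose N := Num.Def.archi_bound e^-1.
have Ne : 1 < N%:R * e.
  by rewrite -ltr_pdivrMr // mul1r archi_boundP // invr_ge0 ltW.
have [/existsP[k hk]|] := boolP [exists k : 'I_N, u k.+1 - u k < e].
  by exists k.
rewrite negb_exists => /forallP h.
suff : N%:R * e <= u N by move=> h1; have /andP[_] := u01 N; lra.
have : (N <= N)%N by []; elim: {1 3 4}N => [_|k IH kN].
  by rewrite mul0r; have /andP[] := u01 0%N.
have := h (Ordinal kN); rewrite -leNgt /= -natr1 => hk.
by have := IH (ltnW kN); lra.
Qed.

Lemma jensen_turan (R : rcfType) (g : nat -> R) k :
  real_rooted (jensen g 2 k) -> g k * g k.+2 <= g k.+1 ^+ 2.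
Proof.
move=> /laguerre_le; have [->|a0] := eqVneq (g k.+2) 0.
  by rewrite mulr0 sqr_ge0.
(* The vertex of the quadratic: the derivative vanishes there, and Laguerre's inequality becomes the
   sign of the discriminant. *)
move=> /(_ (- g k.+1 / g k.+2)).
rewrite !(deriv_jensen, derivZ) !jensenS !jensen0 !hornerE.
set a := g k.+2 in a0 *; set x := g k.+1; set c := g k => h.
have {}h : (c + (- x / a) * x + (- x / a) * (x + (- x / a) * a)) * 2 * 1 * a <=
    (2 * (x + (- x / a) * a)) ^+ 2 by exact: h.
have xa : x / a * a = x by rewrite divfK.
by move: h; rewrite mulNr; set y := x / a in xa *; rewrite -xa; nra.
Qed.

Section JensenRoots.
Variables (R : archiRcfType) (g : nat -> R) (m : nat).
Hypotheses (g_eq0 : forall k, (k < m)%N -> g k = 0)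
  (g_gt0 : forall k, (m <= k)%N -> 0 < g k)
  (g_ndecr : forall k, (m <= k)%N -> g k <= g k.+1)
  (jensen_rr : forall n j, real_rooted (jensen g n j)).

Lemma jensen_ge0 n j i : 0 <= (jensen g n j)`_i.
Proof.
rewrite coef_jensen mulr_ge0 ?ler0n //.
by have [/g_gt0/ltW//|/g_eq0->] := leqP m (i + j).
Qed.

(* u_k = g_k / g_(k+1) is nondecreasing and bounded by 1; the sum of (r + u)^2
   over the roots r is a multiple of the increment of u, so that for some large
   shift all roots are close to -u >= -1. *)
Lemma jensen_sign_large n j0 (b : R) : (m <= j0)%N -> b < - 1 ->
  exists2 j, (j0 <= j)%N &
  forall x, x <= b -> 0 < (- 1) ^+ n.+2 * (jensen g n.+2 j).[x].
Proof.
move=> mj0 b1; pose u k := g (j0 + k)%N / g (j0 + k).+1.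
have mk k : (m <= j0 + k)%N by rewrite (leq_trans mj0) ?leq_addr.
have u01 k : 0 <= u k <= 1.
  rewrite divr_ge0 ?(ltW (g_gt0 _)) ?leqW //=.
  by rewrite ler_pdivrMr ?g_gt0 ?leqW // mul1r g_ndecr.
have u_ndecr k : u k <= u k.+1.
  rewrite /u addnS ler_pdivrMr ?g_gt0 ?leqW // mulrAC ler_pdivlMr ?g_gt0 ?leqW //.
  by rewrite -expr2 jensen_turan.
(* With N = n + 2 roots and consecutive ratios v <= w <= 1, the sum of the (r + w)^2 is N (N - 1) w
   (w - v) <= N^2 (w - v), whereas a root r <= b alone contributes at least (b + 1)^2. *)
have e0 : 0 < (- b - 1) ^+ 2 / (n.+2 ^ 2)%:R.
  by rewrite divr_gt0 ?exprn_gt0 ?ltr0n ?expn_gt0 //; lra.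
have [k] := @bounded_small_increment _ (fun k => u (n + k)%N) _ e0 (fun k => u01 _).
rewrite addnS; have := u_ndecr (n + k)%N; have := u01 (n + k).+1.
move=> /andP[_ u_le1] u_le u_small.
exists (j0 + k)%N => [|x xb]; first exact: leq_addr.
set j := (j0 + k)%N.
have [rs Grs] := real_rooted_split (@jensen_rr n.+2 j).
have gE i : g (i + j)%N = g (j0 + (i + k))%N by rewrite /j addnCA.
have g0 : 0 < g (j0 + (n + k)).+2 by apply: g_gt0; rewrite -!addnS mk.
have g0' : 0 < g (j0 + (n + k)).+1 by apply: g_gt0; rewrite -!addnS mk.
have lG : lead_coef (jensen g n.+2 j) = g (j0 + (n + k)).+2.
  by rewrite lead_coef_poly ?binn ?mul1r ?gE ?addSn ?addnS // gt_eqF.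
have c0 : lead_coef (jensen g n.+2 j) != 0 by rewrite lG gt_eqF.
have sG : size (jensen g n.+2 j) = n.+3.
  by rewrite /jensen size_poly_eq // binn mul1r gE !addSn !addnS gt_eqF.
have srs : size rs = n.+2.
  by apply/eqP; rewrite -eqSS -(size_prod_XsubC rs id) -(size_scale _ c0) -Grs sG.
have [_] := sum_sqr_roots rs; rewrite srs !coefXnM /= !subSS !subn0.
set P := \prod_(_ <- _) _ in Grs *.
have coefP i : P`_i = (jensen g n.+2 j)`_i / g (j0 + (n + k)).+2.
  by rewrite Grs coefZ lG mulrAC divff ?mul1r // gt_eqF.
pose N : R := n.+2%:R.
have cN : 2 * 'C(n.+2, n)%:R = N * (N - 1).
  have <- : 'C(n.+2, n.+2 - 2) = 'C(n.+2, n) by rewrite !subSS subn0.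
  rewrite bin_sub // -natrM -(mul_bin_diag n.+2 1) bin1 natrM /N -[X in X - 1]natr1.
  by rewrite addrK.
rewrite !coefP !coef_jensen !gE binSn -/N.
have -> : (j0 + (n.+1 + k) = (j0 + (n + k)).+1)%N by rewrite addSn addnS.
have uE1 : u (n + k).+1 = g (j0 + (n + k)).+1 / g (j0 + (n + k)).+2.
  by rewrite /u addnS.
move=> s1 s2; rewrite -!mulrA -uE1 in s1 s2.
have gg : g (j0 + (n + k))%N / g (j0 + (n + k)).+2 = u (n + k)%N * u (n + k).+1.
  by rewrite uE1 /u mulrA divfK // gt_eqF.
rewrite {}gg in s2; set v := u (n + k)%N in u_le u_small s2 *.
set w := u (n + k).+1 in u_le u_small u_le1 s1 s2 *.
have N0 : 0 < N by rewrite ltr0n.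
have v0 : 0 <= v by have /andP[] := u01 (n + k)%N.
have sumE : \sum_(r <- rs) (r + w) ^+ 2 = N * (N - 1) * (w * (w - v)).
  have -> : \sum_(r <- rs) (r + w) ^+ 2 = \sum_(r <- rs) r ^+ 2 +
      2 * w * (\sum_(r <- rs) r) + N * w ^+ 2.
    rewrite /N -srs; elim: (rs) => [|r s IH]; first by rewrite !big_nil /=; ring.
    by rewrite !big_cons IH /= -natr1; ring.
  rewrite -s2 -[\sum_(r <- rs) r]opprK -s1 [2 * (_ * _)]mulrA cN; ring.
have rb r : r \in rs -> b < r.
  move=> rin; rewrite ltNge; apply/negP => rb.
  have h1 : (r + w) ^+ 2 <= N * (N - 1) * (w * (w - v)).
    by rewrite -sumE (big_rem r) //= lerDl; apply: sumr_ge0 => i _; apply: sqr_ge0.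
  have h2 : (- b - 1) ^+ 2 <= (r + w) ^+ 2.
    have : (b + 1) ^+ 2 <= (r + w) ^+ 2 by nra.
    by rewrite -opprD sqrrN.
  move: u_small; rewrite ltr_pdivlMr ?ltr0n ?expn_gt0 // natrX -/N => h3.
  have h4 : N * (N - 1) * (w * (w - v)) <= (w - v) * N ^+ 2.
    have h5 : w * (w - v) <= w - v by nra.
    have h6 : 0 <= N * (N - 1) by rewrite -cN mulr_ge0 ?ler0n.
    have := ler_wpM2l h6 h5.
    have : 0 <= N * (w - v) by rewrite mulr_ge0 ?(ltW N0) // subr_ge0.
    nra.
  lra.
rewrite Grs lG hornerZ -srs mulrCA mulr_gt0 // prod_XsubC_sign //.
by apply/allP => r /rb; apply: le_lt_trans.
Qed.

(* By [jensenS] and [deriv_jensen], the Jensen polynomial of shift j is the polar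
   derivative of one whose derivative has shift j + 1: descend from large j. *)
Lemma jensen_sign n j (b : R) : (m <= n.+2)%N -> b < - 1 ->
  forall x, x <= b -> 0 < (- 1) ^+ n.+2 * (jensen g n.+2 j).[x].
Proof.
move=> mn b1.
have [J jJ] := @jensen_sign_large n (maxn m j) b (leq_maxl _ _) b1.
have {}jJ : (j <= J)%N by rewrite (leq_trans _ jJ) ?leq_maxr.
rewrite -(subnK jJ); elim: (J - j)%N => // d IH H; apply: IH => x xb.
rewrite addSn in H; move: (d + j)%N H => {jJ}j H; pose G := jensen g n.+3 j.
have gj i : (n.+2 <= i)%N -> 0 < g (i + j)%N.
  by move=> ni; rewrite g_gt0 // (leq_trans mn) // (leq_trans ni) ?leq_addr.
have dG y : G^`().[y] = n.+3%:R * (jensen g n.+2 j.+1).[y].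
  by rewrite /G deriv_jensen hornerZ.
have := @polar_deriv_step _ G n.+2 b _ (@jensen_rr n.+3 j).
have -> : size G = n.+4 by rewrite /G size_poly_eq // binn mul1r gt_eqF ?gj.
have -> : G`_n.+2 != 0 by rewrite coef_jensen binSn mulf_neq0 ?pnatr_eq0 ?gt_eqF ?gj.
move=> /(_ _ erefl (@jensen_ge0 _ _) isT _ x xb) h.
have {h} : 0 < (-1) ^+ n.+2 * (n.+3%:R * G.[x] - x * G^`().[x]).
  apply: h; first by lra.
  by move=> y yb; rewrite dG mulrCA mulr_gt0 ?ltr0n ?H.
have -> : n.+3%:R * G.[x] - x * G^`().[x] = n.+3%:R * (jensen g n.+2 j).[x].
  by rewrite dG /G jensenS hornerD hornerM hornerX; ring.
by rewrite mulrCA pmulr_rgt0 ?ltr0n.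
Qed.

Lemma jensen_roots n : (m <= n.+2)%N -> exists2 rs : seq R,
  size rs = n.+2 /\ jensen g n.+2 0 = g n.+2 *: \prod_(r <- rs) ('X - r%:P) &
  all (fun r => - 1 <= r <= 0) rs.
Proof.
move=> mn; have gn : 0 < g n.+2 by apply: g_gt0.
have [rs Grs] := real_rooted_split (@jensen_rr n.+2 0).
have sG : size (jensen g n.+2 0) = n.+3.
  by rewrite /jensen size_poly_eq // binn mul1r addn0 gt_eqF.
have lG : lead_coef (jensen g n.+2 0) = g n.+2.
  by rewrite lead_coefE sG coef_jensen binn mul1r addn0.
rewrite lG in Grs; exists rs; first split => //.
  apply/eqP; rewrite -eqSS -(size_prod_XsubC rs id).
  by rewrite -(size_scale _ (lt0r_neq0 gn)) -Grs sG.
apply/allP => r rin; have Gr0 : (jensen g n.+2 0).[r] = 0.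
  by apply/rootP; rewrite Grs rootZ ?gt_eqF // root_prod_XsubC.
apply/andP; split; rewrite leNgt; apply/negP => r1.
  by have := jensen_sign 0 mn r1 (lexx r); rewrite Gr0 mulr0 ltxx.
move: Gr0; apply/eqP; rewrite gt_eqF // horner_coef sG big_ord_recr /= ltr_wpDl //.
  by apply: sumr_ge0 => i _; rewrite mulr_ge0 ?jensen_ge0 // exprn_ge0 // ltW.
by rewrite mulr_gt0 ?exprn_gt0 // coef_jensen binn mul1r addn0.
Qed.

End JensenRoots.

(** * The falling factorial approximation *)

Lemma poly_eq_horner (F : numFieldType) (p q : {poly F}) :
  (forall x, p.[x] = q.[x]) -> p = q.
Proof.
move=> pq; apply/eqP; rewrite -subr_eq0; apply: contraT => r0.
pose s : seq F := [seq k%:R | k <- iota 0 (size (p - q))].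
have : (size s < size (p - q)%R)%N.
  apply: max_poly_roots => //.
    by apply/allP => x _; apply/rootP; rewrite hornerD hornerN pq subrr.
  rewrite map_inj_uniq ?iota_uniq // => i j /eqP.
  by rewrite eqr_nat => /eqP.
by rewrite size_map size_iota ltnn.
Qed.

(** The umbral functional X^k -> g_k, which turns polynomial identities into identities for [g]. *)
Definition moment (R : nzRingType) (g : nat -> R) (p : {poly R}) : R :=
  \sum_(k < size p) p`_k * g k.

Section Moment.
Variables (R : comNzRingType) (g : nat -> R).
Implicit Types p q : {poly R}.

Lemma moment_wide n p : (size p <= n)%N -> moment g p = \sum_(k < n) p`_k * g k.
Proof.
move=> sp; rewrite /moment (big_ord_widen _ (fun k => p`_k * g k) sp).
rewrite big_mkcond; apply: eq_bigr => i _; case: ltnP => // h.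
by rewrite nth_default ?mul0r.
Qed.

Lemma moment_is_linear : scalar (moment g).
Proof.
move=> a p q; pose n := maxn (size p) (size q).
rewrite !(@moment_wide n) ?leq_maxl ?leq_maxr //; last first.
  by rewrite (leq_trans (size_polyD _ _)) // geq_max leq_maxr andbT
     (leq_trans (size_scale_leq _ _)) // leq_maxl.
rewrite mulr_sumr -big_split; apply: eq_bigr => k _ /=.
by rewrite coefD coefZ mulrDl mulrA.
Qed.

HB.instance Definition _ :=
  @GRing.isLinear.Build R {poly R} R *%R (moment g) moment_is_linear.

Lemma momentXn k : moment g 'X^k = g k.
Proof.
rewrite (@moment_wide k.+1) ?size_polyXn // big_ord_recr big1 /= => [|i _].
  by rewrite coefXn eqxx mul1r add0r.
by rewrite coefXn ltn_eqF ?mul0r.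
Qed.

(** The i-th forward difference of [g] at 0; [moment_diff_inv] is Newton's interpolation formula. *)
Definition moment_diff i := moment g (('X - 1) ^+ i).

Lemma moment_diff_inv n : g n = \sum_(i < n.+1) 'C(n, i)%:R * moment_diff i.
Proof.
rewrite -momentXn -['X in LHS](subrK 1) addrC exprDn linear_sum.
apply: eq_bigr => i _; rewrite expr1n mul1r linearMn /=.
by rewrite mulr_natl.
Qed.

(* Both sides are the functional [moment g] at ((1 - x) + x X)^M = (1 + x (X - 1))^M. *)
Lemma bernstein_moment M x :
  \sum_(k < M.+1) 'C(M, k)%:R * g k * (x ^+ k * (1 - x) ^+ (M - k)) =
  \sum_(i < M.+1) 'C(M, i)%:R * moment_diff i * x ^+ i.
Proof.
transitivity (moment g (((1 - x)%:P + x *: 'X) ^+ M)).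
  rewrite exprDn linear_sum; apply: eq_bigr => k _.
  rewrite linearMn /= -polyC_exp mul_polyC exprZn scalerA linearZ /= momentXn.
  by rewrite -mulr_natl; ring.
have -> : (1 - x)%:P + x *: 'X = 1 + x *: ('X - 1).
  by rewrite scalerBr -mul_polyC polyCB polyC1 -[x *: 1]mul_polyC; ring.
rewrite exprDn linear_sum; apply: eq_bigr => i _.
rewrite expr1n mul1r linearMn exprZn linearZ /= -mulr_natl /moment_diff; ring.
Qed.

End Moment.

(** The quotient is the product of the 1 - j/M for j < i. The crude i^2 suffices, and makes the
    lower bound trivial for i > M. *)
Lemma ffact_ratio_bound (R : realFieldType) M i : (0 < M)%N ->
  1 - (i ^ 2)%:R / M%:R <= ((M ^_ i)%:R / M%:R ^+ i : R) <= 1.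
Proof.
move=> M0; have M0' : 0 < M%:R :> R by rewrite ltr0n.
elim: i => [|i /andP[IH1 IH2]].
  by rewrite ffactn0 expr0 divr1 mul0r subr0 lexx.
have a0 : 0 <= (M ^_ i)%:R / M%:R ^+ i :> R.
  by rewrite divr_ge0 ?ler0n ?exprn_ge0 ?ler0n.
have i2 : ((i.+1 ^ 2)%:R = (i ^ 2)%:R + 2 * i%:R + 1 :> R).
  by rewrite !natrX -natr1; ring.
have sE : (M ^_ i.+1)%:R / M%:R ^+ i.+1 =
    (M ^_ i)%:R / M%:R ^+ i * ((M - i)%N%:R / M%:R) :> R.
  by rewrite ffactnSr natrM exprSr invfM mulrACA.
have [iM|Mi] := leqP i M.
  rewrite sE natrB // mulrBl divff ?gt_eqF //.
  set a := _ / _ ^+ i in IH1 IH2 a0 *.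
  have b0 : 0 <= i%:R / M%:R :> R by rewrite divr_ge0 ?ler0n.
  have b1 : i%:R / M%:R <= 1 :> R by rewrite ler_pdivrMr // mul1r ler_nat.
  rewrite i2 !mulrDl -mulrA mul1r.
  have : 0 < M%:R^-1 :> R by rewrite invr_gt0.
  set b := i%:R / _ in b0 b1 *; set c := _^-1; set d := _ * c in IH1 *.
  by move=> c0; apply/andP; split; nra.
rewrite ffact_small ?ltnS ?(ltnW Mi) // mul0r ler01 andbT.
rewrite subr_le0 ler_pdivlMr // mul1r ler_nat.
by rewrite -mulnn; nia.
Qed.

Lemma sum_ffact_wide (R : nzRingType) (c : nat -> R) n K : (n <= K)%N ->
  \sum_(i < K.+1) c i * (n ^_ i)%:R = \sum_(i < n.+1) c i * (n ^_ i)%:R.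
Proof.
move=> nK; rewrite [RHS](big_ord_widen K.+1 (fun i => c i * (n ^_ i)%:R)) //.
rewrite [RHS]big_mkcond; apply: eq_bigr => i _; case: ltnP => // ni.
by rewrite ffact_small ?mulr0.
Qed.

Section HermiteLimit.
Variables (R : archiRcfType) (g : nat -> R) (m : nat).
Hypotheses (g_eq0 : forall k, (k < m)%N -> g k = 0)
  (g_gt0 : forall k, (m <= k)%N -> 0 < g k)
  (g_ndecr : forall k, (m <= k)%N -> g k <= g k.+1)
  (jensen_rr : forall n j, real_rooted (jensen g n j)).

Local Notation delta := (moment_diff g).

(** By [bernstein_moment] the left side is (1 - x)^(n+2) J(x / (1 - x)) for the Jensen polynomial J;
    a root r of J contributes x - r (1 - x). *)
Lemma bernstein_factor n : (m <= n.+2)%N -> exists2 rs : seq R,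
  \poly_(i < n.+3) ('C(n.+2, i)%:R * delta i) =
    g n.+2 *: \prod_(r <- rs) ((1 + r) *: 'X + (- r)%:P) &
  all (fun r => - 1 <= r <= 0) rs.
Proof.
move=> mn; have [rs [srs Jrs] rs01] := jensen_roots g_eq0 g_gt0 g_ndecr jensen_rr mn.
exists rs => //.
(* Multiplying both sides by X - 1 disposes of x = 1, where x / (1 - x) has no meaning. *)
have X1 : 'X - 1%:P != 0 :> {poly R} by rewrite polyXsubC_eq0.
apply: (mulIf X1).
apply: poly_eq_horner => x; rewrite !hornerM hornerXsubC.
have [->|x1] := eqVneq x 1; first by rewrite subrr !mulr0.
congr (_ * _); have y0 : 1 - x != 0 by rewrite subr_eq0 eq_sym.
rewrite horner_poly -bernstein_moment hornerZ.
transitivity ((1 - x) ^+ n.+2 * (jensen g n.+2 0).[x / (1 - x)]).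
  rewrite horner_poly mulr_sumr; apply: eq_bigr => k _.
  have -> : (1 - x) ^+ n.+2 = (1 - x) ^+ (n.+2 - k) * (1 - x) ^+ k.
    by rewrite -exprD subnK // -ltnS.
  rewrite addn0 exprMn exprVn.
  by field; rewrite expf_neq0.
rewrite Jrs hornerZ mulrCA; congr (_ * _); rewrite -srs !horner_prod.
elim: (rs) => [|r s IH]; first by rewrite !big_nil mulr1.
rewrite !big_cons [size _]/= exprS -IH !(hornerXsubC, hornerD, hornerZ, hornerX, hornerC).
rewrite mulrACA; congr (_ * _).
by field.
Qed.

(** Roots r = 0 give the factors X, collected in X^l; the others have the positive constant term
    -r. *)
Lemma hermite_stable_factor c N (rs : seq R) : 0 < N ->
  all (fun r => - 1 <= r <= 0) rs ->
  hermite_stable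
    (falling_eval (c *: \prod_(r <- rs) (((1 + r) / N) *: 'X + (- r)%:P))).
Proof.
move=> N0 rs01; suff [d [l [s [-> sP]]]] : exists d l (s : seq (R * R)),
    \prod_(r <- rs) (((1 + r) / N) *: 'X + (- r)%:P) =
      d *: ('X^l * \prod_(ab <- s) (ab.1 *: 'X + ab.2%:P)) /\
    all (fun ab => (0 <= ab.1) && (0 < ab.2)) s.
  by rewrite scalerA; apply: hermite_stable_falling_eval.
elim: rs rs01 => [|r rs IH] /=.
  by exists 1, 0%N, [::]; rewrite !big_nil expr0 mulr1 scale1r.
move=> /andP[/andP[r1 r0] /IH[d [l [s [e sP]]]]].
rewrite big_cons e; have [->|rn0] := eqVneq r 0.
  exists (N^-1 * d), l.+1, s; split=> //.
  rewrite addr0 mul1r oppr0 polyC0 addr0 exprS -!mul_polyC polyCM; ring.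
exists d, l, (((1 + r) / N, - r) :: s); split.
  by rewrite big_cons /= -!mul_polyC; ring.
rewrite /= sP andbT divr_ge0 ?(ltW N0) //=; last lra.
by rewrite oppr_gt0 lt_neqAle rn0.
Qed.

(** Replacing x by x/M in [bernstein_factor] and passing to falling factorials multiplies the i-th
    Newton term of g_n by M(M-1)...(M-i+1) / M^i, which tends to 1 with an error of at most i^2 /
    M. *)
Lemma nondecreasing_multiplier_hermite_stable : hermite_stable g.
Proof.
apply: hermite_stable_closed => d e e0.
pose a n i := delta i * (n ^_ i)%:R / i`!%:R.
pose B := \sum_(n < d.+1) \sum_(i < n.+1) `|a n i| * (i ^ 2)%:R.
have B0 : 0 <= B.
  by apply: sumr_ge0 => n _; apply: sumr_ge0 => i _; rewrite mulr_ge0 ?ler0n.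
pose n0 := (Num.Def.archi_bound (B / e) + m + d)%N; pose M := n0.+2.
have M0 : 0 < M%:R :> R by rewrite ltr0n.
have BM : B / M%:R <= e.
  rewrite ler_pdivrMr // mulrC -ler_pdivrMr // ltW //.
  rewrite (lt_le_trans (archi_boundP _)) ?divr_ge0 ?(ltW e0) // ler_nat.
  by rewrite /M /n0 -addnA -addn2 -addnA leq_addr.
have mM : (m <= n0.+2)%N by rewrite /n0; lia.
have dM : (d < M.+1)%N by rewrite /M /n0; lia.
have [rs Prs rs01] := bernstein_factor mM.
exists (falling_eval (g M *: \prod_(r <- rs) (((1 + r) / M%:R) *: 'X + (- r)%:P))).
  exact: hermite_stable_factor.
move=> n nd.
have -> : g M *: \prod_(r <- rs) (((1 + r) / M%:R) *: 'X + (- r)%:P) =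
    \poly_(i < M.+1) ('C(M, i)%:R * delta i / M%:R ^+ i).
  apply: poly_eq_horner => x; rewrite horner_poly hornerZ horner_prod.
  transitivity ((\poly_(i < n0.+3) ('C(n0.+2, i)%:R * delta i)).[x / M%:R]).
    rewrite Prs hornerZ horner_prod; congr (_ * _); apply: eq_bigr => r _.
    by rewrite !(hornerD, hornerZ, hornerX, hornerC) mulrAC -mulrA.
  rewrite horner_poly; apply: eq_bigr => i _.
  by rewrite exprMn exprVn; field; rewrite expf_neq0 // gt_eqF.
have binE k i : 'C(k, i)%:R = (k ^_ i)%:R / i`!%:R :> R.
  by rewrite -bin_ffact natrM mulfK // pnatr_eq0 -lt0n fact_gt0.
rewrite (falling_eval_wide _ (size_poly _ _)).
have -> : \sum_(i < M.+1) (\poly_(i < M.+1) ('C(M, i)%:R * delta i / M%:R ^+ i))`_i *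
    (n ^_ i)%:R = \sum_(i < n.+1) a n i * ((M ^_ i)%:R / M%:R ^+ i).
  have nM : (n <= M)%N by rewrite (leq_trans nd).
  transitivity (\sum_(i < M.+1) 'C(M, i)%:R * delta i / M%:R ^+ i * (n ^_ i)%:R).
    by apply: eq_bigr => i _; rewrite coef_poly ltn_ord.
  rewrite (@sum_ffact_wide _ (fun i => 'C(M, i)%:R * delta i / M%:R ^+ i) n M nM).
  by apply: eq_bigr => i _; rewrite binE /a; ring.
have gE : g n = \sum_(i < n.+1) a n i.
  rewrite (moment_diff_inv g n); apply: eq_bigr => i _.
  by rewrite binE /a; ring.
rewrite {1}gE -sumrB (le_trans (ler_norm_sum _ _ _)) // (le_trans _ BM) //.
apply: (@le_trans _ _ ((\sum_(i < n.+1) `|a n i| * (i ^ 2)%:R) / M%:R)); last first.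
  rewrite ler_pM2r ?invr_gt0 // /B.
  rewrite (bigD1 (Ordinal (nd : (n < d.+1)%N))) //= lerDl.
  by apply: sumr_ge0 => k _; apply: sumr_ge0 => i _; rewrite mulr_ge0 ?ler0n.
rewrite mulr_suml; apply: ler_sum => i _.
rewrite -[X in _ - X]mulr1 -mulrBr normrM -mulrA ler_wpM2l //.
have /andP[h1 h2] := @ffact_ratio_bound R M i isT.
by rewrite ler_norml; apply/andP; split; lra.
Qed.

End HermiteLimit.

(** * Hermite multiplier sequences *)

Definition hermite_multiplier (R : rcfType) (g : nat -> R) :=
  forall p : {poly R}, real_rooted p -> real_rooted (diag_op (hermite R) g p).

Section HermiteMultiplier.
Variable R : rcfType.
Implicit Types (g : nat -> R) (p : {poly R}).
Local Notation "p ^C" := (map_poly (real_complex R) p).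
Local Notation size_H := (@size_hermite R).

Lemma hermite_stable_multiplier g : hermite_stable g -> hermite_multiplier g.
Proof.
move=> st p /st; rewrite /real_rooted; congr upper_stable.
have [c pc] := simple_set_span size_H (leqnn (size p)).
have diagE : diag_op (hermite R) g p = \sum_(k < size p) (c k * g k) *: hermite R k.
  rewrite [in LHS]pc linear_sum; apply: eq_bigr => k _.
  by rewrite linearZ /= (diag_op_basis size_H) scalerA.
have pCE : p^C = \sum_(k < size p) (c k)%:C *: hermite R[i] k.
  rewrite [in LHS]pc (rmorph_sum (map_poly (real_complex R))).
  by apply: eq_bigr => k _; rewrite /= map_polyZ map_hermite.
rewrite pCE linear_sum diagE (rmorph_sum (map_poly (real_complex R))).
apply: eq_bigr => k _; rewrite linearZ /= (diag_op_basis (@size_hermite R[i])).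
by rewrite map_polyZ map_hermite scalerA rmorphM.
Qed.

Lemma eq_hermite_multiplier g1 g2 : g1 =1 g2 ->
  hermite_multiplier g1 -> hermite_multiplier g2.
Proof. by move=> g12 gm p /gm; rewrite (eq_diag_op _ g12). Qed.

Lemma upper_stable_hermite n : upper_stable (hermite R[i] n).
Proof.
elim: n => [|n IH]; first by move=> z _; rewrite /= (negPf (root1 z)).
have -> : hermite R[i] n.+1 = 2 *: hermite_raise (hermite R[i] n).
  by rewrite hermite_raiseE scalerA divff ?scale1r // pnatr_eq0.
exact/upper_stableZ/upper_stable_raise.
Qed.

(** At a zero in the upper half-plane, dividing by H_n leaves a + b (2z - H_n'/H_n) = 0, where the
    bracket has positive imaginary part. *)
Lemma real_rooted_hermite2 a b n :
  real_rooted (a *: hermite R n + b *: hermite R n.+1).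
Proof.
rewrite /real_rooted rmorphD /= !map_polyZ.
rewrite -[map_poly _ (hermite R n.+1)]/((hermite R n.+1)^C) !map_hermite.
have [->|b0] := eqVneq b 0.
  by rewrite scale0r addr0; apply/upper_stableZ/upper_stable_hermite.
have h0 : hermite R[i] n != 0 by rewrite -size_poly_gt0 size_hermite.
move=> z z0; have [uz h] := upper_stable_logderiv_le (@upper_stable_hermite n) h0 z0.
rewrite rootE hornerD !hornerZ [hermite _ n.+1]/=.
set u := hermite _ n in uz h *; rewrite hornerD hornerN hornerMn hornerM hornerX.
move=> /eqP e; exfalso.
have : a%:C + b%:C * (2%:R%:C * (z - 2^-1%:C * (u^`().[z] / u.[z]))) = 0.
  apply: (mulIf uz); rewrite mul0r -[RHS]e fmorphV rmorph_nat.
  by field.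
move=> /(congr1 (@complex.Im R)); rewrite !ImD !Im_realM ImD ImN Im_realM /= add0r.
move/eqP; rewrite mulf_eq0 (negPf b0) mulf_eq0 pnatr_eq0 /= => /eqP; lra.
Qed.

Lemma hermite_multiplier_two_terms g m :
  (forall k, k != m -> k != m.+1 -> g k = 0) -> hermite_multiplier g.
Proof.
move=> g0 p _; have [c ->] := simple_set_span size_H (leqW (leqW (leq_maxr m (size p)))).
rewrite linear_sum /=.
have -> : \sum_(i < (maxn m (size p)).+2) diag_op (hermite R) g (c i *: hermite R i) =
    \sum_(i < (maxn m (size p)).+2) (c i * g i) *: hermite R i.
  apply: eq_bigr => k _; rewrite linearZ /=.
  by rewrite (diag_op_basis size_H) scalerA.
have mK : (m < (maxn m (size p)).+2)%N by rewrite ltnS leqW ?leq_maxl.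
have mK' : (m.+1 < (maxn m (size p)).+2)%N by rewrite ltnS ltnS leq_maxl.
rewrite (bigD1 (Ordinal mK)) // (bigD1 (Ordinal mK')) /=; last first.
  by rewrite -val_eqE /= gtn_eqF.
rewrite big1 ?addr0 => [|k /andP[km km']]; first exact: real_rooted_hermite2.
by rewrite g0 ?mulr0 ?scale0r.
Qed.

Lemma hermite_comp_sign (t : R) n : t ^+ 2 = 1 ->
  hermite R n \Po (t *: 'X) = t ^+ n *: hermite R n.
Proof.
move=> t2; elim: n => [|n IH]; first by rewrite /= comp_polyC scale1r.
have dH : (hermite R n)^`() \Po (t *: 'X) = t ^+ n.+1 *: (hermite R n)^`().
  have := congr1 (@deriv R) IH; rewrite deriv_comp !derivZ derivX => e.
  rewrite exprS -scalerA -e mulrC -scalerAl mul1r scalerA -expr2 t2 scale1r.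
  by [].
rewrite [hermite _ _.+1]/= mulr2n comp_polyB comp_polyD dH comp_polyM comp_polyX IH.
by rewrite scalerBr scalerDr -!scalerAl -!scalerAr scalerA exprS.
Qed.

(** As t is 1 or -1, the parity of H_k makes x -> t x contribute t^k. *)
Lemma hermite_multiplier_sign g s t : t ^+ 2 = 1 ->
  hermite_multiplier g -> hermite_multiplier (fun k => s * t ^+ k * g k).
Proof.
move=> t2 gm p pr; have := @real_rootedZ R s _ (@real_rooted_scale R _ t (gm _ pr)).
congr real_rooted.
pose S : {linear {poly R} -> {poly R}} :=
  s \*: (comp_poly (t *: 'X) \o diag_op (hermite R) g).
apply: (eigen_diag_op size_H (T := S)) => k.
rewrite /S /= (diag_op_basis size_H) comp_polyZ hermite_comp_sign // !scalerA.
by congr (_ *: _); ring.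
Qed.

End HermiteMultiplier.

(** * Sufficient conditions for a Hermite multiplier sequence *)

Section MultiplierConditions.
Variables (R : archiRcfType) (g : nat -> R).
Hypotheses (jensen_rr : forall n j, real_rooted (jensen g n j))
  (g_same_parity : forall k, 0 <= g k * g k.+2)
  (g_step2 : forall k, g k.+2 * g k <= g k.+2 ^+ 2)
  (g_gap : forall k, g k.+3 = 0 -> g k.+4 = 0 -> g k.+2 != 0 -> g k = 0).

(** Turan's inequality and [g_same_parity] force g_(k+2) = 0. If g_i were nonzero, a nonconstant
    Jensen polynomial J would have J(0) != 0 and J'(0) = J''(0) = 0, against the strict Laguerre
    inequality. *)
Lemma multiplier_eventually_zero k : g k != 0 -> g k.+1 = 0 ->
  forall i, (k < i)%N -> g i = 0.
Proof.
move=> gk gk1 i ki.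
have gk2 : g k.+2 = 0.
  have h := jensen_turan (@jensen_rr 2 k); rewrite gk1 expr0n /= in h.
  apply/eqP; have := g_same_parity k; rewrite le_eqVlt ltNge h orbF eq_sym.
  by rewrite mulf_eq0 (negPf gk).
have [//|gi] := eqVneq (g i) 0; exfalso.
pose J := jensen g (i - k) k.
have J0 : J.[0] = g k by rewrite horner_coef0 coef_jensen bin0 mul1r.
have dJ : J^`().[0] = 0.
  by rewrite horner_coef0 coef_deriv coef_jensen add1n gk1 mulr0.
have ddJ : J^`()^`().[0] = 0.
  by rewrite horner_coef0 !coef_deriv coef_jensen add2n gk2 mulr0 mul0rn.
have := @laguerre_lt _ J 0 (@jensen_rr _ _).
rewrite J0 dJ ddJ mulr0 expr0n /= ltxx gk => /(_ _ isT)/wrap[]//.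
rewrite ltnNge; apply/negP => /leq_sizeP/(_ (i - k)%N); rewrite subn_gt0 => /(_ ki).
rewrite coef_jensen binn mul1r subnK ?(ltnW ki) // => /eqP.
by rewrite (negPf gi).
Qed.

(** Here [k] is the last index of the support; were it at least m + 2, [g_gap] would give g_(k-2) =
    0 inside the support. *)
Lemma multiplier_hermite_eventually_zero m k :
  (forall i, (i < m)%N -> g i = 0) -> (m <= k)%N ->
  (forall i, (m <= i <= k)%N -> g i != 0) -> g k.+1 = 0 ->
  hermite_multiplier g.
Proof.
move=> gm mk gmk gk1; have gk : g k != 0 by rewrite gmk ?mk ?leqnn.
have gk0 := multiplier_eventually_zero gk gk1.
apply: (@hermite_multiplier_two_terms _ _ m) => i im im1.
have [/gm//|mi] := ltnP i m; have [/gk0//|ik] := ltnP k i.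
have m2k : (m.+2 <= k)%N.
  rewrite (leq_trans _ ik) //; move: mi im im1.
  by rewrite leq_eqVlt eq_sym => /orP[->//|]; rewrite leq_eqVlt eq_sym => /orP[->|].
case: k mk gmk gk1 gk gk0 ik m2k => [|[|k]] // mk gmk gk1 gk gk0 _ mk2.
have /eqP : g k = 0 by apply: g_gap => //; apply: gk0.
by rewrite (negPf (gmk _ _)) // -2!ltnS mk2 leqW.
Qed.

(** The signs at k and k + 2 agree, so they have the form s t^k with s and t equal to 1 or -1, and
    [hermite_multiplier_sign] reduces the claim to |g|. *)
Lemma multiplier_hermite_nonzero m :
  (forall i, (i < m)%N -> g i = 0) -> (forall i, (m <= i)%N -> g i != 0) ->
  hermite_multiplier g.
Proof.
move=> gm g_neq0; pose e k := Num.sg (g k).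
have e2 k : (m <= k)%N -> e k ^+ 2 = 1.
  by move=> mk; rewrite sqr_sg g_neq0.
have eSS k : (m <= k)%N -> e k.+2 = e k.
  move=> mk; have := e2 _ mk; have := e2 _ (leqW (leqW mk)) => h1 h2.
  have : 0 <= e k * e k.+2 by rewrite -sgrM sgr_ge0.
  move/eqP: h1; rewrite sqrf_eq1 => /orP[]/eqP->; move/eqP: h2;
    by rewrite sqrf_eq1 => /orP[]/eqP-> //; lra.
pose t := e m * e m.+1; have t2 : t ^+ 2 = 1 by rewrite exprMn !e2 // mulr1.
have eE i : e (m + i)%N = e m * t ^+ i.
  suff [] : e (m + i)%N = e m * t ^+ i /\ e (m + i).+1 = e m * t ^+ i.+1 by [].
  elim: i => [|i [IH1 IH2]].
    rewrite addn0 expr0 mulr1 expr1 /t mulrA -expr2 e2 // mul1r; split=> //.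
  rewrite addnS IH2; split=> //; rewrite eSS ?leq_addr // IH1.
  by rewrite -addn2 exprD t2 mulr1.
(* Since t^2 = 1, the power t^m also serves as t^(-m). *)
pose s := e m * t ^+ m; have s2 : s ^+ 2 = 1.
  by rewrite exprMn e2 // mul1r -exprM mulnC exprM t2 expr1n.
have gE k : g k = s * t ^+ k * `|g k|.
  have [/gm->|mk] := ltnP k m; first by rewrite normr0 mulr0.
  rewrite {1}[g k]numEsg -/(e k) -{1}(subnKC mk) eE /s -[in t ^+ k](subnKC mk) exprD.
  congr (_ * _); rewrite mulrA -[_ * _ * t ^+ m]mulrA -expr2 -exprM mulnC exprM t2.
  by rewrite expr1n mulr1.
apply: (@eq_hermite_multiplier _ (fun k => s * t ^+ k * `|g k|)) => [k|].
  by rewrite -gE.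
apply: hermite_multiplier_sign => //; apply: hermite_stable_multiplier.
have g_pos k : (m <= k)%N -> 0 < `|g k| by move=> mk; rewrite normr_gt0 g_neq0.
apply: (@nondecreasing_multiplier_hermite_stable _ _ m) => [k km||k mk|n j] //.
- by rewrite gm ?normr0.
(* [g_step2] gives |g_k| <= |g_(k+2)|, and Turan then gives g_k^2 <= |g_k g_(k+2)| <= g_(k+1)^2. *)
- have h1 := jensen_turan (@jensen_rr 2 k).
  have h2 := g_step2 k; have g1 := g_pos k mk; have g3 := g_pos k.+2 (leqW (leqW mk)).
  have gg : g k * g k.+2 = `|g k| * `|g k.+2| by rewrite -normrM ger0_norm.
  have h3 : `|g k| <= `|g k.+2|.
    by rewrite -(ler_pM2r g3) -gg mulrC -expr2 real_normK ?num_real.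
  have h4 : `|g k| ^+ 2 <= `|g k.+1| ^+ 2.
    rewrite [leRHS]real_normK ?num_real // (le_trans _ h1) // gg expr2.
    by rewrite ler_pM2l.
  by rewrite -(@ler_pXn2r _ 2) ?nnegrE.
have -> : jensen (fun k => `|g k|) n j = (s * t ^+ j) *: (jensen g n j \Po (t *: 'X)).
  apply/polyP => k; rewrite coefZ coef_comp_polyZX !coef_jensen.
  rewrite [in RHS](gE (k + j)%N) exprD.
  have tk i : t ^+ i * t ^+ i = 1 by rewrite -expr2 -exprM mulnC exprM t2 expr1n.
  transitivity (s ^+ 2 * (t ^+ j * t ^+ j) * (t ^+ k * t ^+ k) *
      ('C(n, k)%:R * `|g (k + j)%N|)).
    by rewrite s2 !tk !mul1r.
  by ring.
exact/real_rootedZ/real_rooted_scale.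
Qed.

Lemma multiplier_conditions_hermite : hermite_multiplier g.
Proof.
have [[k gk]|g0] := Classical_Prop.classic (exists k, g k != 0); last first.
  apply: (@hermite_multiplier_two_terms _ _ 0) => k _ _.
  by apply/eqP; apply/negPn/negP => gk; apply: g0; exists k.
have exg : exists k, [pred k | g k != 0] k by exists k.
case: (ex_minnP exg) => m /= gm mmin {exg}.
have gm0 i : (i < m)%N -> g i = 0.
  by move=> im; apply/eqP; apply: contraTT im => /mmin; rewrite leqNgt.
have [[i hi]|h] :=
  Classical_Prop.classic (exists i, (m <= i)%N && (g i == 0)); last first.
  apply: (multiplier_hermite_nonzero gm0) => i mi.
  by apply/negP => gi; apply: h; exists i; rewrite mi.
have exg : exists i, [pred i | (m <= i)%N && (g i == 0)] i by exists i.
case: (ex_minnP exg) => -[|j] /= /andP[mj /eqP gj] jmin {exg}.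
  by move: mj gm; rewrite leqn0 => /eqP->; rewrite gj eqxx.
apply: (multiplier_hermite_eventually_zero gm0 _ _ gj).
  by rewrite -ltnS ltn_neqAle mj andbT; apply: contraNneq gm => ->; rewrite gj.
move=> l /andP[ml lj]; apply/negP => gl; have := jmin l; rewrite ml gl.
by move=> /(_ isT); rewrite ltnNge lj.
Qed.

End MultiplierConditions.

(** * Legendre multiplier sequences *)

(** The factor c - x changes sign at c; a nonzero value of A + B x there would make the product
    change sign too. The range x >= c / 2 is what [legendre_gap] can supply, where x - c / 2 has to
    be nonnegative. *)
Lemma affine_sign_change (R : realFieldType) (A B c k : R) :
  0 < c -> k != 0 ->
  (forall x, c / 2 <= x -> (c - x) * k * (A + B * x) <= 0) -> A + B * c = 0.
Proof.
move=> c0 k0 H; pose V := k * (A + B * c).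
have Hp t : 0 <= t -> t <= c / 2 -> t * V <= t * (k * B) * t.
  move=> t0 tc; have := H (c - t) ltac:(lra).
  have -> : (c - (c - t)) * k * (A + B * (c - t)) = t * V - t * (k * B) * t.
    by rewrite /V; ring.
  by rewrite subr_le0.
have Hn t : 0 <= t -> - t * (k * B) * t <= t * V.
  move=> t0; have := H (c + t) ltac:(lra).
  have -> : (c - (c + t)) * k * (A + B * (c + t)) = - t * (k * B) * t - t * V.
    by rewrite /V; ring.
  by rewrite subr_le0.
have V0 : V = 0.
  (* For t <= |V| / D one has 2 |k B| t <= |V|, against |V| <= |k B| t from the points c - t and c +
     t. *)
  pose D := `|V| + 1 + 2 * `|k * B|; have D0 : 0 < D.
    by rewrite /D; have := normr_ge0 V; have := normr_ge0 (k * B); lra.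
  have [//|Vn0] := eqVneq V 0; have Vpos : 0 < `|V| by rewrite normr_gt0.
  pose t := Num.min (c / 2) (`|V| / D).
  have t0 : 0 < t by rewrite lt_min !divr_gt0.
  have tc : t <= c / 2 by rewrite ge_min lexx.
  have tV : t * D <= `|V| by rewrite -ler_pdivlMr // ge_min lexx orbT.
  have kB : `|k * B| * t * 2 <= `|V|.
    apply: le_trans tV; rewrite /D mulrDr mulrDr.
    by have := mulr_ge0 (ltW t0) (ltW Vpos); lra.
  have h1 : V <= (k * B) * t.
    by have := Hp t (ltW t0) tc; rewrite -mulrA ler_pM2l.
  have h2 : - (k * B) * t <= V.
    have := Hn t (ltW t0); have -> : - t * (k * B) * t = t * (- (k * B) * t) by ring.
    by rewrite ler_pM2l.
  have kBn := ler_norm (k * B); have kBn' := ler_norm (- (k * B)).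
  rewrite normrN in kBn'.
  have VV : `|V| <= `|k * B| * t by rewrite ler_norml; apply/andP; split; nra.
  by exfalso; lra.
by apply/eqP; move/eqP: V0; rewrite mulf_eq0 (negPf k0).
Qed.

Section LegendreRecurrence.
Variables (R : archiRcfType) (P : nat -> {poly R}).
Hypotheses (P0 : P 0%N = 1) (P1 : P 1%N = 'X)
  (P_rec : forall n, n.+2%:R *: P n.+2 =
     n.*2.+3%:R *: ('X * P n.+1) - n.+1%:R *: P n).

Lemma legendre_coef n k : n.+2%:R * (P n.+2)`_k =
  n.*2.+3%:R * (if k is k'.+1 then (P n.+1)`_k' else 0) - n.+1%:R * (P n)`_k.
Proof.
by have := congr1 (fun p : {poly R} => p`_k) (P_rec n);
   rewrite !coefE; case: k.
Qed.

Lemma legendre_size n : (size (P n) <= n.+1)%N /\ 0 < (P n)`_n.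
Proof.
suff [] : ((size (P n) <= n.+1)%N /\ 0 < (P n)`_n) /\
  ((size (P n.+1) <= n.+2)%N /\ 0 < (P n.+1)`_n.+1) by [].
elim: n => [|n [[s1 c1] [s2 c2]]].
  by rewrite P0 P1 size_poly1 size_polyX coef1 coefX ltr01.
split=> //; split.
  apply/leq_sizeP => [[|k]] // nk.
  apply: (mulfI (_ : n.+2%:R != 0 :> R)); first by rewrite pnatr_eq0.
  rewrite legendre_coef mulr0 !nth_default ?mulr0 ?subr0 //.
    by rewrite (leq_trans s1) // ltnW // ltnW.
  exact: leq_trans s2 _.
rewrite -(pmulr_rgt0 _ (_ : 0 < n.+2%:R :> R)) ?ltr0n // legendre_coef.
rewrite [(P n)`_n.+2]nth_default ?(leqW s1) // mulr0 subr0.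
by rewrite mulr_gt0 ?ltr0n.
Qed.

Lemma size_legendre n : size (P n) = n.+1.
Proof.
have [s c] := legendre_size n; apply/eqP; rewrite eqn_leq s ltnNge.
by apply: contraTN c => h; rewrite nth_default ?ltxx.
Qed.

Lemma legendre_parity n k : odd (n + k) -> (P n)`_k = 0.
Proof.
suff [/(_ k)] : (forall k, odd (n + k) -> (P n)`_k = 0) /\
  (forall k, odd (n.+1 + k) -> (P n.+1)`_k = 0) by [].
elim: n => [|n [IH1 IH2]].
  rewrite P0 P1; split=> [[|j]|[|[|j]]] //=; by rewrite ?coef1 ?coefX.
split=> // -[|j] o; apply: (mulfI (_ : n.+2%:R != 0 :> R)); rewrite ?pnatr_eq0 //;
  rewrite legendre_coef mulr0.
  by rewrite IH1 ?mulr0 ?subr0 //; move: o; rewrite !addSn /= negbK.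
rewrite IH1 ?IH2 ?mulr0 ?subr0 //; last by move: o; rewrite !addSn /= negbK.
by move: o; rewrite !addSn addnS /= !negbK.
Qed.

Lemma legendre_second_coef n : (P n.+2)`_n < 0.
Proof.
elim: n => [|n IH].
  rewrite -(pmulr_rlt0 _ (_ : 0 < 2%:R :> R)) ?ltr0n // legendre_coef P0 coef1.
  by rewrite mulr0 sub0r eqxx mulr1 oppr_lt0 ltr01.
rewrite -(pmulr_rlt0 _ (_ : 0 < n.+3%:R :> R)) ?ltr0n // legendre_coef.
have [_ c] := legendre_size n.+1.
have h1 : n.+1.*2.+3%:R * (P n.+2)`_n < 0 by rewrite pmulr_rlt0 ?ltr0n.
have h2 : 0 < n.+2%:R * (P n.+1)`_n.+1 by rewrite mulr_gt0 ?ltr0n.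
lra.
Qed.

Section Multiplier.
Variables (g : nat -> R) (T : {linear {poly R} -> {poly R}}).
Hypotheses (TP : forall k, T (P k) = g k *: P k)
  (T_rr : forall p, real_rooted p -> real_rooted (T p)).

Let T_size := eigen_size_le size_legendre TP.
Let T_coef := eigen_coef size_legendre TP.

(** T commutes with x -> -x, both being diagonal in the basis [P]. *)
Lemma legendre_op_parity n k : odd (n + k) -> (T 'X^n)`_k = 0.
Proof.
move=> o.
pose s : {linear {poly R} -> {poly R}} := comp_poly (-1 *: 'X).
have sP j : s (P j) = (-1) ^+ j *: P j.
  apply/polyP => i; rewrite /s coef_comp_polyZX coefZ.
  have [oij|eij] := boolP (odd (j + i)); first by rewrite legendre_parity // mulr0 mul0r.
  rewrite mulrC; congr (_ * _); rewrite -(signr_odd _ i) -(signr_odd _ j).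
  by move: eij; rewrite oddD negb_add => /eqP->.
pose A : {linear {poly R} -> {poly R}} := T \o s.
pose B : {linear {poly R} -> {poly R}} := s \o T.
have AB : A 'X^n = B 'X^n.
  apply: (linear_eq_simple_set size_legendre (S := A) (T := B)) => j.
  rewrite /A /B /= -/(s _) -/(s _) TP sP !linearZ /= sP TP.
  by rewrite !scalerA mulrC.
have := congr1 (fun p : {poly R} => p`_k) AB.
have sX : s 'X^n = (-1) ^+ n *: 'X^n.
  apply/polyP => i; rewrite /s coef_comp_polyZX coefZ !coefXn.
  by have [->|_] := eqVneq i n; rewrite ?mulr0 ?mul0r // mulrC.
rewrite /A /B /= -/(s _) sX coef_comp_polyZX linearZ coefZ => e.
have e' : ((-1) ^+ n - (-1) ^+ k) * (T 'X^n)`_k = 0.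
  by rewrite mulrBl e mulrC subrr.
apply/eqP; move/eqP: e'; rewrite mulf_eq0 => /orP[|//].
rewrite -(signr_odd _ n) -(signr_odd _ k); move: o; rewrite oddD.
by case: (odd n); case: (odd k) => //= _; rewrite ?expr0 ?expr1 => h;
  exfalso; move/eqP: h; lra.
Qed.

(** Write P_(n+2) = l X^(n+2) + b X^n + lower terms. The coefficient of X^n in T P_(n+2) = g_(n+2)
    P_(n+2) gives l w + b g_n = b g_(n+2) for the coefficient w in question, so c = -b / l with b <
    0 < l. *)
Lemma legendre_op_second_coef n : exists2 c : R, 0 < c &
  (T 'X^(n.+2))`_n = c * (g n - g n.+2).
Proof.
have [_ l0] := legendre_size n.+2; have b0 := legendre_second_coef n.
set l := (P n.+2)`_n.+2 in l0; set b := (P n.+2)`_n in b0.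
exists (- (b / l)); first by rewrite oppr_gt0 pmulr_llt0 ?invr_gt0.
have [r sr rE] : exists2 r : {poly R}, (size r <= n)%N &
    P n.+2 = l *: 'X^(n.+2) + b *: 'X^n + r.
  exists (P n.+2 - l *: 'X^(n.+2) - b *: 'X^n); last by ring.
  apply/leq_sizeP => j nj; rewrite !coefB !coefZ !coefXn.
  have nn2 : (n == n.+2) = false by apply/eqP; lia.
  have [->|jn] := eqVneq j n; first by rewrite nn2 mulr0 mulr1 subr0 subrr.
  have [->|jn2] := eqVneq j n.+2; first by rewrite mulr1 mulr0 subrr subr0.
  rewrite !mulr0 !subr0; have [->|jn1] := eqVneq j n.+1.
    by rewrite legendre_parity // oddD /=; case: (odd n).
  by rewrite nth_default // size_legendre; lia.
have := congr1 (fun p : {poly R} => p`_n) (TP n.+2).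
rewrite {1}rE !linearD !linearZ /= !coefD !coefZ -/b.
rewrite (@T_coef n 'X^n) ?size_polyXn // coefXn eqxx mulr1.
rewrite [(T r)`_n]nth_default ?T_size // addr0 => e.
apply: (mulfI (lt0r_neq0 l0)).
have -> : l * (T 'X^(n.+2))`_n = g n.+2 * b - b * g n by rewrite -e addrK.
by field; rewrite gt_eqF.
Qed.

(** The test polynomial is x^j (1 + x)^n; its factor x^j produces the shift and is divided out
    afterwards. *)
Lemma legendre_jensen_real_rooted n j : real_rooted (jensen g n j).
Proof.
pose p : {poly R} := 'X^j * (1 + 'X) ^+ n.
have pr : real_rooted p.
  apply: real_rootedM; first exact: real_rootedX.
  apply: real_rootedXn; rewrite addrC -['X]scale1r.
  exact: (@real_rooted_linear R 1 1).
have := multiplier_monomial size_legendre TP T_rr pr.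
have -> : \poly_(i < size p) (g i * p`_i) = 'X^j * jensen g n j :> {poly R}.
  apply/polyP => i; rewrite coef_diag_poly /p !coefXnM.
  case: ltnP => [|ji]; first by rewrite mulr0.
  rewrite coef_jensen subnK // mulrC; congr (_ * _).
  rewrite exprDn coef_sum.
  under eq_bigr do rewrite expr1n mul1r coefMn coefXn.
  have [lt|ge] := ltnP (i - j) n.+1.
    rewrite (bigD1 (Ordinal lt)) //= eqxx big1 ?addr0 // => k kij.
    by rewrite [_ == _]negbTE ?mul0rn // eq_sym.
  rewrite bin_small // big1 // => k _.
  by rewrite gtn_eqF ?mul0rn // (leq_trans (ltn_ord k)).
by apply: real_rooted_divl; rewrite -size_poly_eq0 size_polyXn.
Qed.

(** The test polynomial x^k (1 - x^2) yields g_k - g_(k+2) x^2, to which Laguerre's inequality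
    applies at 0. *)
Lemma legendre_same_parity k : 0 <= g k * g k.+2.
Proof.
pose p : {poly R} := 'X^k * (1 - 'X^2).
have pr : real_rooted p.
  apply: real_rootedM; first exact: real_rootedX.
  have -> : 1 - 'X^2 = (-1 *: 'X + 1%:P) * (1 *: 'X + 1%:P) :> {poly R}.
    by rewrite scaleN1r scale1r !exprS; ring.
  by apply: real_rootedM; apply: real_rooted_linear.
have := multiplier_monomial size_legendre TP T_rr pr.
have -> : \poly_(i < size p) (g i * p`_i) = 'X^k * ((g k)%:P - g k.+2 *: 'X^2)
    :> {poly R}.
  apply/polyP => i; rewrite coef_diag_poly /p !coefXnM.
  case: ltnP => [|ki]; first by rewrite mulr0.
  rewrite -{1}(subnK ki); move: (i - k)%N => {ki i} i.
  rewrite !(coefB, coefC, coefZ, coefXn, coef1).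
  by case: i => [|[|[|i]]] /=; rewrite ?add0n ?add2n; ring.
have Xk : 'X^k != 0 :> {poly R} by rewrite -size_poly_eq0 size_polyXn.
move=> h; have := @laguerre_le _ _ 0 (@real_rooted_divl _ _ _ Xk h).
rewrite !horner_coef0 !coef_deriv !coefB !coefC !coefZ !coefXn /=.
by rewrite !(mulr0, mulr1, subr0, sub0r, mul0rn) expr0n /=; lra.
Qed.

Lemma legendre_step2 k : g k.+2 * g k <= g k.+2 ^+ 2.
Proof.
have Xr : real_rooted ('X^(k.+2) : {poly R}).
  exact: real_rootedX.
have sT : (size (T 'X^(k.+2)) <= k.+3)%N by rewrite T_size ?size_polyXn.
have := top_coef_sign (T_rr Xr) sT.
rewrite legendre_op_parity; last by rewrite oddD /=; case: (odd k).
move=> /(_ erefl); rewrite T_coef ?size_polyXn // coefXn eqxx mulr1.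
have [c c0 ->] := legendre_op_second_coef k.
rewrite mulrCA pmulr_rle0 //; lra.
Qed.

(* T applied to X^k (X^2 - r) (X^2 - s) has only its coefficients of degree
   k+2 and k, k-2, ... left; the sign of the first one changes when r + s
   crosses a critical value, that of the second one does not. *)
Lemma legendre_gap k : g k.+3 = 0 -> g k.+4 = 0 -> g k.+2 != 0 -> g k = 0.
Proof.
move=> g3 g4 g2; have [c c0 cE] := legendre_op_second_coef k.+2.
set w := (T 'X^(k.+4))`_k; set t := (T 'X^(k.+2))`_k.
rewrite g4 subr0 in cE.
have key (r s : R) : 0 <= r -> 0 <= s ->
    (c - (r + s)) * g k.+2 * (w - (r + s) * t + r * s * g k) <= 0.
  move=> r0 s0; pose p : {poly R} := 'X^(k.+4) - (r + s) *: 'X^(k.+2) + (r * s) *: 'X^k.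
  have sq_rr (a : R) : 0 <= a -> real_rooted ('X^2 - a%:P : {poly R}).
    move=> a0; have -> : 'X^2 - a%:P =
        (1 *: 'X + (Num.sqrt a)%:P) * (1 *: 'X + (- Num.sqrt a)%:P) :> {poly R}.
      rewrite -[in LHS](sqr_sqrtr a0) polyCN polyC_exp scale1r; ring.
    by apply: real_rootedM; apply: real_rooted_linear.
  have pr : real_rooted p.
    have -> : p = 'X^k * (('X^2 - r%:P) * ('X^2 - s%:P)).
      by rewrite /p -!mul_polyC polyCD polyCM !exprS; ring.
    apply: real_rootedM; last by apply: real_rootedM; apply: sq_rr.
    exact: real_rootedX.
  have TpE i : (T p)`_i = (T 'X^(k.+4))`_i - (r + s) * (T 'X^(k.+2))`_i +
      r * s * (T 'X^k)`_i.
    rewrite /p linearD linearB !(linearZ_LR T).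
      by rewrite coefD coefB !coefZ.
  have sX i j : (i < j)%N -> (T 'X^i)`_j = 0.
    by move=> ij; rewrite nth_default // T_size ?size_polyXn.
  have Tp_par i : odd (k + i) -> (T p)`_i = 0.
    move=> o; have o2 : odd (k.+2 + i) by rewrite !addSn /= negbK.
    have o4 : odd (k.+4 + i) by rewrite !addSn /= !negbK.
    by rewrite TpE !legendre_op_parity // !mulr0 subrr addr0.
  have sT : (size (T p) <= k.+3)%N.
    apply/leq_sizeP => j kj.
    rewrite TpE [(T 'X^(k.+2))`_j]sX // [(T 'X^k)`_j]sX; last by lia.
    rewrite !mulr0 subr0 addr0; have [->|j4] := eqVneq j k.+4.
      by rewrite T_coef ?size_polyXn // g4 mul0r.
    have [->|j3] := eqVneq j k.+3.
      by rewrite legendre_op_parity // oddD /=; case: (odd k).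
    by rewrite sX //; lia.
  have := top_coef_sign (T_rr pr) sT (Tp_par k.+1 _).
  rewrite !TpE -/w -/t cE.
  have TX i : (T 'X^i)`_i = g i by rewrite T_coef ?size_polyXn // coefXn eqxx mulr1.
  have Tk2 : (T 'X^k)`_k.+2 = 0 by apply: sX; lia.
  rewrite !TX Tk2.
  rewrite mulr0 addr0 -mulrBl.
  by apply; rewrite oddD /=; case: (odd k).
have c2 : 0 <= c / 2 by lra.
(* With s = 0 and x = r the coefficient of degree k is affine in x. *)
have eA : w + (- t) * c = 0.
  apply: (affine_sign_change c0 g2) => x x0.
  have := key x 0 ltac:(lra) (lexx 0); rewrite addr0 mulr0 mul0r addr0.
  by rewrite mulNr [t * x]mulrC.
(* With s = c / 2 and r = x - c / 2 it is again affine in x; at x = c it exceeds the previous value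
   by (c^2 / 4) g_k. *)
have eB : (w - c / 2 * (c / 2) * g k) + (- t + c / 2 * g k) * c = 0.
  apply: (affine_sign_change c0 g2) => x x0.
  have := key (x - c / 2) (c / 2) ltac:(lra) c2; rewrite subrK.
  congr (_ * _ <= 0); ring.
have : c ^+ 2 * g k = 0 by lra.
by move/eqP; rewrite mulf_eq0 expf_eq0 /= gt_eqF //= => /eqP.
Qed.

Lemma legendre_multiplier_hermite : hermite_multiplier g.
Proof.
exact: (multiplier_conditions_hermite legendre_jensen_real_rooted
  legendre_same_parity legendre_step2 legendre_gap).
Qed.

End Multiplier.

Lemma legendre_nat_not_multiplier :
  ~ forall p, real_rooted p -> real_rooted (diag_op P (fun k => k%:R) p).
Proof.
pose T := diag_op P (fun k => k%:R); have TP k : T (P k) = k%:R *: P k.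
  exact: (diag_op_basis size_legendre).
have P2 : P 2 = 2^-1 *: (3 *: 'X^2 - 1).
  apply: (scalerI (_ : 2%:R != 0 :> R)); first by rewrite pnatr_eq0.
  by rewrite P_rec P0 P1 scalerA divff ?pnatr_eq0 // !scale1r.
have P3 : P 3 = 2^-1 *: (5 *: 'X^3 - 3 *: 'X).
  apply: (scalerI (_ : 3%:R != 0 :> R)); first by rewrite pnatr_eq0.
  rewrite P_rec P1 P2 -!mul_polyC /=.
  have hh : (2^-1)%:P * 2%:P = 1 :> {poly R} by rewrite -polyCM mulVf ?pnatr_eq0.
  rewrite -[1.*2.+3]/5%N !polyC_natr in hh *; move: (2^-1)%:P hh => h hh.
  have -> : 2 * 'X = 2 * 'X * (h * 2) :> {poly R} by rewrite hh mulr1.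
  by rewrite !exprS; ring.
have cubeE : ('X + 1%:P) ^+ 3 =
    (2 / 5) *: P 3 + 2 *: P 2 + (18 / 5) *: P 1%N + 2 *: P 0%N :> {poly R}.
  apply: poly_eq_horner => x; rewrite P3 P2 P1 P0.
  rewrite !(hornerD, hornerN, hornerZ, hornerXn, hornerX, hornerC, horner_exp).
  by field.
pose Q : {poly R} := 3 *: 'X^3 + 6 *: 'X^2 + (9 / 5) *: 'X - 2%:P.
have TQ : T (('X + 1%:P) ^+ 3) = Q.
  rewrite cubeE /T !linearD !linearZ /= -/T !TP P3 P2 P1 P0.
  apply: poly_eq_horner => x.
  rewrite /Q !(hornerD, hornerN, hornerZ, hornerXn, hornerX, hornerC).
  by field.
have cube_rr : real_rooted (('X + 1%:P) ^+ 3 : {poly R}).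
  by apply: real_rootedXn; have := @real_rooted_linear R 1 1; rewrite scale1r.
move=> /(_ _ cube_rr); rewrite -/T TQ => /laguerre_le.
(* Q(-1) = -4/5, Q'(-1) = -6/5 and Q''(-1) = -6, so Q Q'' = 24/5 exceeds Q'^2 = 36/25. *)
move=> /(_ (- 1)).
have d1 : Q^`() = 9 *: 'X^2 + 12 *: 'X + (9 / 5)%:P.
  by apply/polyP => [[|[|[|[|i]]]]]; rewrite /Q coef_deriv !coefE /=; field.
have d2 : Q^`()^`() = 18 *: 'X + 12%:P.
  by rewrite d1; apply/polyP => [[|[|[|i]]]]; rewrite coef_deriv !coefE /=; field.
rewrite d2 d1 /Q !(hornerD, hornerN, hornerZ, hornerXn, hornerX, hornerC).
lra.
Qed.

End LegendreRecurrence.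

(** * The generating functions *)

From Stdlib Require Import Reals Lra.
From Coquelicot Require Import Coquelicot.

Local Open Scope R_scope.

Lemma ex_pseries_radius_gt0 (b : nat -> RR) (r : RR) : 0 < r ->
  (forall t : RR, Rabs t < r -> ex_pseries b t) -> Rbar_lt 0 (CV_radius b).
Proof.
intros r0 H.
destruct (Rbar_lt_le_dec (CV_radius b) (Rabs (r / 2))) as [h|h].
- exfalso; apply (CV_disk_outside b (r / 2) h).
  assert (e : ex_pseries b (r / 2)).
  { apply H; rewrite Rabs_pos_eq; Lra.lra. }
  apply ex_series_lim_0 in e; revert e.
  apply is_lim_seq_ext; intros n; rewrite pow_n_pow; unfold scal; simpl.
  unfold mult; simpl; ring.
- eapply Rbar_lt_le_trans; [|exact h]; simpl; apply Rabs_pos_lt; Lra.lra.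
Qed.

(* The generating function G satisfies (1 - 2xt + t^2) G' = (x - t) G; the
   recurrence compares the coefficients of the two sides. *)
Lemma legendre_generating_recurrence (a : nat -> RR) (x r : RR) : 0 < r ->
  (forall t : RR, Rabs t < r ->
     is_series (fun k => a k * t ^ k) (/ sqrt (1 - 2 * x * t + t ^ 2))) ->
  a 0%nat = 1 /\ a 1%nat = x * a 0%nat /\
  forall n, INR (S (S n)) * a (S (S n)) =
    (2 * INR n + 3) * x * a (S n) - INR (S n) * a n.
Proof.
intros r0 H.
set (D := fun t => 1 - 2 * x * t + t ^ 2).
assert (Hps : forall t, Rabs t < r -> is_pseries a t (/ sqrt (D t))).
{ intros t ht; unfold is_pseries; generalize (H t ht).
  apply is_series_ext; intros n; rewrite pow_n_pow; unfold scal; simpl.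
  unfold mult; simpl; ring. }
assert (HG : forall t, Rabs t < r -> PSeries a t = / sqrt (D t)).
{ intros t ht; apply is_pseries_unique, Hps, ht. }
assert (Hrad : Rbar_lt 0 (CV_radius a)).
{ apply (ex_pseries_radius_gt0 r0); intros t ht; eexists; apply Hps, ht. }
assert (Hrad2 : exists r1, 0 < r1 /\
  forall t, Rabs t < r1 -> Rbar_lt (Rabs t) (CV_radius a)).
{ destruct (CV_radius a) as [c| |]; simpl in Hrad.
  - exists c; split; [exact Hrad|intros t ht; exact ht].
  - exists 1; split; [Lra.lra|intros t ht; exact I].
  - contradiction. }
destruct Hrad2 as [r1 [r10 Hr1]].
(* For |t| < d one has 2xt < 1, so 1 - 2xt + t^2 is positive and its square root differentiable. *)
set (d := / (2 * (Rabs x + 1))).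
assert (Hx := Rabs_pos x).
assert (d0 : 0 < d) by (apply Rinv_0_lt_compat; Lra.lra).
assert (HD : forall t, Rabs t < d -> 0 < D t).
{ intros t ht; unfold D.
  assert (h : 2 * x * t <= 2 * (Rabs x + 1) * Rabs t).
  { assert (h1 := Rle_abs (x * t)); rewrite Rabs_mult in h1.
    assert (h2 := Rabs_pos t); Lra.nra. }
  assert (h2 : 2 * (Rabs x + 1) * Rabs t < 1).
  { apply (Rlt_le_trans _ (2 * (Rabs x + 1) * d)).
    - apply Rmult_lt_compat_l; Lra.lra.
    - right; unfold d; field; Lra.lra. }
  assert (h3 := pow2_ge_0 t); Lra.lra. }
set (rho := Rmin r (Rmin r1 d)).
assert (rho0 : 0 < rho) by (unfold rho; repeat apply Rmin_pos; assumption).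
assert (Hrho : forall t, Rabs t < rho -> Rabs t < r /\ Rabs t < r1 /\ Rabs t < d).
{ intros t ht; unfold rho in ht.
  assert (h1 := Rmin_l r (Rmin r1 d)); assert (h2 := Rmin_r r (Rmin r1 d)).
  assert (h3 := Rmin_l r1 d); assert (h4 := Rmin_r r1 d); Lra.lra. }
assert (Hode : forall t, Rabs t < rho ->
   D t * PSeries (PS_derive a) t = (x - t) * PSeries a t).
{ intros t ht; destruct (Hrho t ht) as [h1 [h2 h3]].
  assert (hD := HD t h3).
  assert (e1 : is_derive (PSeries a) t (PSeries (PS_derive a) t)).
  { apply is_derive_PSeries, Hr1, h2. }
  assert (e2 : is_derive (fun t => / sqrt (D t)) t ((x - t) * / sqrt (D t) / D t)).
  { unfold D; auto_derive.
    - fold (D t); repeat split; try assumption; try exact I.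
      apply Rgt_not_eq, sqrt_lt_R0; exact hD.
    - replace (1 + - (2 * x * t) + t * (t * 1)) with (D t) by (unfold D; ring).
      replace (1 - 2 * x * t + t ^ 2) with (D t) by reflexivity.
      assert (hs := sqrt_lt_R0 _ hD).
      assert (hq := sqrt_sqrt (D t) (Rlt_le _ _ hD)).
      set (s := sqrt (D t)) in *; rewrite <- hq; field; Lra.lra. }
  assert (e3 : is_derive (PSeries a) t ((x - t) * / sqrt (D t) / D t)).
  { apply (is_derive_ext_loc (fun t => / sqrt (D t))); [|exact e2].
    assert (hp : 0 < r - Rabs t) by Lra.lra.
    exists (mkposreal _ hp); intros y hy; symmetry; apply HG.
    assert (hy' : Rabs (y - t) < r - Rabs t) by exact hy.
    assert (h4 := Rabs_triang (y - t) t).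
    assert (h5 : forall u v : RR, u - v + v = u) by (intros; ring).
    rewrite h5 in h4; Lra.lra. }
  apply is_derive_unique in e1; apply is_derive_unique in e3.
  rewrite <- e1, e3, (HG t h1); field; split; [|Lra.lra].
  apply Rgt_not_eq, sqrt_lt_R0, hD. }
set (a' := PS_derive a) in *.
(* The coefficients of the left side of the differential equation, and in [c] those of the right
   side; [PS_incr_1] is multiplication by t. *)
set (b := PS_plus a'
  (PS_plus (PS_scal (- 2 * x) (PS_incr_1 a')) (PS_incr_1 (PS_incr_1 a')))).
set (c := PS_plus (PS_scal x a) (PS_scal (- 1) (PS_incr_1 a))).
assert (exa : forall t, Rabs t < rho -> ex_pseries a t).
{ intros t ht; eexists; apply Hps, Hrho, ht. }
assert (exa' : forall t, Rabs t < rho -> ex_pseries a' t).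
{ intros t ht; apply CV_radius_inside; unfold a'; rewrite CV_radius_derive.
  apply Hr1, Hrho, ht. }
assert (exs : forall (k : RR) (u : nat -> RR) (t : RR),
  ex_pseries u t -> ex_pseries (PS_scal k u) t).
{ intros k u t hu; apply ex_pseries_scal; [apply Rmult_comm|exact hu]. }
assert (exi : forall (u : nat -> RR) (t : RR),
  ex_pseries u t -> ex_pseries (PS_incr_1 u) t).
{ intros u t hu; apply (ex_pseries_incr_1 u t hu). }
assert (exb2 : forall t, Rabs t < rho ->
  ex_pseries (PS_plus (PS_scal (- 2 * x) (PS_incr_1 a')) (PS_incr_1 (PS_incr_1 a'))) t).
{ intros t ht; apply ex_pseries_plus; auto. }
assert (exb : forall t, Rabs t < rho -> ex_pseries b t).
{ intros t ht; apply ex_pseries_plus; auto. }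
assert (exc : forall t, Rabs t < rho -> ex_pseries c t).
{ intros t ht; apply ex_pseries_plus; auto. }
assert (bcE : forall t : RR, Rabs t < rho -> PSeries b t = PSeries c t).
{ intros t ht; unfold b, c; rewrite !PSeries_plus; auto.
  rewrite !PSeries_scal !PSeries_incr_1.
  replace (x * PSeries a t + -1 * (t * PSeries a t)) with ((x - t) * PSeries a t) by ring.
  rewrite <- (Hode t ht); unfold D; ring. }
assert (bc : forall n, b n = c n).
{ intros n; apply PSeries_ext_recip.
  - apply (ex_pseries_radius_gt0 rho0 exb).
  - apply (ex_pseries_radius_gt0 rho0 exc).
  - exists (mkposreal _ rho0); intros t ht; apply bcE.
    rewrite <- (Rminus_0_r t); exact ht. }
split; [|split].
- rewrite <- (PSeries_0 a), HG; [|rewrite Rabs_R0; exact r0].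
  unfold D; replace (1 - 2 * x * 0 + 0 ^ 2) with 1 by ring.
  rewrite sqrt_1; field.
- generalize (bc 0%nat); unfold b, c, a', PS_plus, PS_scal, PS_derive; simpl.
  unfold plus, scal; simpl; unfold mult, zero; simpl; intros h; Lra.lra.
- intros n.
  assert (h : INR (S (S n)) * a (S (S n)) +
      (- 2 * x * (INR (S n) * a (S n)) + INR n * a n) = x * a (S n) + -1 * a n).
  { assert (e : PS_incr_1 a' n = INR n * a n).
    { destruct n as [|n]; [symmetry; exact (Rmult_0_l (a 0%nat))|reflexivity]. }
    rewrite <- e; exact (bc (S n)). }
  replace (INR (S (S n)) * a (S (S n))) with
    (x * a (S n) + -1 * a n - (- 2 * x * (INR (S n) * a (S n)) + INR n * a n))
    by Lra.lra.
  rewrite S_INR; ring.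
Qed.

(** * The Rodrigues formula for Hermite polynomials *)

Lemma is_derive_horner (p : {poly RR}) (x : RR) :
  is_derive (fun y => horner p y) x (horner (deriv p) x).
Proof.
elim/poly_ind: p x => [|p c IH] x.
  rewrite deriv0 horner0; apply: (is_derive_ext (fun _ => 0)).
    by move=> t; rewrite horner0.
  exact: is_derive_const.
rewrite derivD derivM derivX derivC addr0 mulr1 !(hornerD, hornerM, hornerX).
apply: (is_derive_ext (fun y => horner p y * y + c)).
  by move=> t; rewrite !(hornerD, hornerM, hornerX, hornerC).
have h := is_derive_plus _ _ _ _ _
  (is_derive_mult _ _ _ _ _ (IH x) (is_derive_id x) Rmult_comm) (is_derive_const c x).
move: h; rewrite /plus /mult /zero /one /= !RplusE !RmultE addr0 mulr1.
by [].
Qed.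

Lemma Derive_n_gauss n (x : RR) :
  Derive_n (fun y => exp (- (y ^ 2))) n x =
  (-1) ^ n * horner (hermite RR n) x * exp (- (x ^ 2)).
Proof.
elim: n x => [|n IH] x.
  have -> : (hermite RR 0).[x] = 1 by rewrite hornerC.
  by rewrite /= !Rmult_1_l.
rewrite [LHS]/= (Derive_ext _ _ _ IH); apply: is_derive_unique.
have hp := is_derive_horner (hermite RR n) x.
have he : is_derive (fun y => exp (- (y ^ 2))) x (- 2 * x * exp (- (x ^ 2))).
  by auto_derive; [exact I | rewrite /=; ring].
have E : (hermite RR n.+1).[x] =
    x * (hermite RR n).[x] + x * (hermite RR n).[x] - ((hermite RR n)^`()).[x].
  by rewrite /= hornerD hornerN hornerMn hornerM hornerX mulr2n.
rewrite E; move: hp he; set h := (hermite RR n)^`().[x] => hp he.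
have := is_derive_mult _ _ x _ _ (is_derive_scal _ x ((-1) ^ n) _ hp) he Rmult_comm.
have -> : (-1) ^ n.+1 * (x * (hermite RR n).[x] + x * (hermite RR n).[x] - h) *
     exp (- x ^ 2) = (-1) ^ n * h * exp (- x ^ 2) +
     (-1) ^ n * (hermite RR n).[x] * (-2 * x * exp (- x ^ 2)) by rewrite /=; ring.
by [].
Qed.

Lemma hermite_family_eq (H : nat -> {poly RR}) : is_hermite_family H ->
  forall n, H n = hermite RR n.
Proof.
move=> HH n; apply: poly_eq_horner => x; rewrite HH Derive_n_gauss.
have e1 : exp (x ^ 2) * exp (- (x ^ 2)) = 1.
  by rewrite -exp_plus Rplus_opp_r exp_0.
have e2 : (-1) ^ n * (-1) ^ n = 1.
  by rewrite -Rpow_mult_distr; replace (-1 * -1) with 1 by ring; rewrite pow1.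
have e3 (u v w h : RR) : u * v * (u * h * w) = u * u * (v * w) * h by ring.
by rewrite e3 e1 e2 !Rmult_1_l.
Qed.

Local Close Scope R_scope.

(** The radius of convergence depends on x, so the recurrence is derived at each x and only then
    lifted to polynomials. *)
Lemma legendre_family_recurrence (Le : nat -> {poly RR}) : is_legendre_family Le ->
  [/\ Le 0 = 1, Le 1 = 'X & forall n, n.+2%:R *: Le n.+2 =
     n.*2.+3%:R *: ('X * Le n.+1) - n.+1%:R *: Le n].
Proof.
move=> HL; have rec (x : RR) :
  ((Le 0%nat).[x] = 1 /\ (Le 1%nat).[x] = x * (Le 0%nat).[x] /\
    forall n, INR n.+2 * (Le n.+2).[x] =
      (2 * INR n + 3) * x * (Le n.+1).[x] - INR n.+1 * (Le n).[x])%R.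
  have [r [r0 hr]] := HL x.
  exact: (legendre_generating_recurrence (a := fun k => (Le k).[x]) r0 hr).
split=> [||n]; apply: poly_eq_horner => x; have [h0 [h1 h]] := rec x.
- by rewrite hornerC.
- by rewrite hornerX h1 h0 Rmult_1_r.
rewrite hornerD hornerN !hornerZ hornerM hornerX -!INRE.
have -> : INR n.*2.+3 = (2 * INR n + 3)%R.
  by rewrite -addnn !S_INR plus_INR; ring.
have := h n; rewrite Rmult_assoc => e; exact: e.
Qed.

Theorem theorem3p7 (Le H : nat -> {poly RR}) :
  is_legendre_family Le -> is_hermite_family H ->
  (forall gamma : nat -> RR,
      legendre_multiplier_sequence Le gamma ->
      hermite_multiplier_sequence H gamma) /\
  (exists gamma : nat -> RR,
      hermite_multiplier_sequence H gamma /\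
      ~ legendre_multiplier_sequence Le gamma).
Proof.
move=> /legendre_family_recurrence[Le0 Le1 Lerec] /hermite_family_eq HE.
have sLe := size_legendre Le0 Le1 Lerec.
have hermite_seq (g : nat -> RR) :
    hermite_multiplier g -> hermite_multiplier_sequence H g.
  move=> gm T TH p /only_real_zerosP/gm h; apply/only_real_zerosP.
  have TE : forall q, T q = diag_op (hermite RR) g q.
    by apply: (eigen_diag_op (@size_hermite RR)) => k; rewrite -HE TH.
  by rewrite TE.
split=> [g gL|].
  apply: hermite_seq; pose T := diag_op Le g.
  have TLe k : T (Le k) = g k *: Le k by exact: (diag_op_basis sLe).
  apply: (legendre_multiplier_hermite Le0 Le1 Lerec TLe) => p /only_real_zerosP pr.
  exact/only_real_zerosP/gL.
exists (fun k => k%:R); split.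
  apply/hermite_seq/hermite_stable_multiplier.
  apply: eq_hermite_stable (hermite_stable_step0 (@hermite_stable1 RR)) => n.
  by rewrite mulr1.
move=> gL; apply: (legendre_nat_not_multiplier Le0 Le1 Lerec) => p /only_real_zerosP pr.
apply/only_real_zerosP; apply: (gL _ _ p pr) => k; exact: (diag_op_basis sLe).
Qed.
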